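(* Let $v\le w'$ in $S_n$ be such that $\mathcal N_{v,w'}$ is toric, let $\mathcal C$ be a chain from $v$ to $w'$ in $[v,w']$, and let $w'\lessdot w$ with $w=w't_{a,b}$. Then $\mathcal N_{v,w}$ is toric if and only if the vertices $a$ and $b$ are not in the same connected component of $G_{\mathcal C}$.
   Context: $\le$ is the Bruhat order on $S_n$, $\ell$ is the Coxeter length, $w'\lessdot w$ means $w'<w$ and $\ell(w)=\ell(w')+1$, and $t_{a,b}$ is the transposition of $a$ and $b$ (right multiplication by $t_{a,b}$ swaps positions $a$ and $b$). For a (saturated) chain $\mathcal C: v=u_0\lessdot u_1\lessdot\cdots\lessdot u_l=w'$, the undirected graph $G_{\mathcal C}$ has vertex set $[n]$ and an edge $(a,b)$ whenever $u_{i+1}=u_it_{a,b}$ for some $0\le i\le l-1$. Let $B$ (resp. $B_-$) be the upper (resp. lower) triangular Borel subgroup of $G=GL_n(\mathbb C)$ and $T$ the diagonal torus. For $v\le w$ the Kazhdan-Lusztig variety is $\mathcal N_{v,w}=\overline{BwB/B}\cap B_-vB/B\subset G/B$; its dimension is $\ell(w)-\ell(v)$. The usual torus action is the action of $T$ by left multiplication. With $D^\circ(v)=\{(i,j): v(j)<i,\ v^{-1}(i)>j\}$, its weight cone is $\sigma_{v,w}=\mathrm{Cone}(e_{v(j)}-e_i : (i,j)\in D^\circ(v),\ t_{v(j),i}\,v\le w)\subset\mathbb R^n$. The complexity of $\mathcal N_{v,w}$ is $\dim\mathcal N_{v,w}-\dim\sigma_{v,w}$, and $\mathcal N_{v,w}$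 is called toric if its complexity is $0$. *)

(* Defs.v *)
From HB Require Import structures.
From mathcomp Require Import all_boot all_order all_fingroup all_algebra.
From mathcomp Require Import complex.
From mathcomp Require Import -(notations) mpoly.
From mathcomp Require Import all_classical all_reals ereal topology.
Set Implicit Arguments.
Unset Strict Implicit.
Unset Printing Implicit Defensive.

Import Order.TTheory GRing.Theory Num.Theory.
Local Open Scope classical_set_scope.
Local Open Scope ring_scope.
Local Open Scope complex_scope.
Local Open Scope quotient_scope.

(* The set [n] is 'I_n = {0, ..., n-1}. *)

Section Permutations.
Variable n : nat.
Implicit Types (u v w : 'S_n) (C : seq 'S_n).

(* The product u v of the literature, (u v)(i) = u (v i).  MathComp composes
   permutations in the opposite order: (s * t)%g i = t (s i). *)
Definition perm_compose u v : 'S_n := (v * u)%g.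

Definition simple_transp : {set 'S_n} :=
  [set t | [exists i : 'I_n, exists j : 'I_n,
     (j == i.+1 :> nat) && (t == tperm i j)]]%SET.

Lemma simple_transp_word w : exists k : nat, w \in (simple_transp ^+ k)%g.
Proof.
have adj (x y : 'I_n) : (x < y)%N -> tperm x y \in <<simple_transp>>%g.
  case: y => m; elim: m => [//|m IH] lt_m xm.
  have lt_m' : (m < n)%N by apply: ltnW.
  have smp : tperm (Ordinal lt_m') (Ordinal lt_m) \in <<simple_transp>>%g.
    apply: mem_gen; rewrite inE; apply/existsP; exists (Ordinal lt_m').
    by apply/existsP; exists (Ordinal lt_m); rewrite /= !eqxx.
  have [xm'|] := ltnP x m; last first.
    move=> mx; suff -> : x = Ordinal lt_m' by [].
    by apply: val_inj; apply/eqP; rewrite eqn_leq mx andbT -ltnS.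
  have neq : Ordinal lt_m != x by rewrite -val_eqE /= gtn_eqF.
  have neq' : Ordinal lt_m' != Ordinal lt_m by rewrite -val_eqE /= ltn_eqF.
  suff -> : tperm x (Ordinal lt_m) =
    (tperm x (Ordinal lt_m') ^ tperm (Ordinal lt_m') (Ordinal lt_m))%g.
    by apply: groupJ => //; apply: IH.
  rewrite tpermJ tpermL tpermD // -val_eqE /= gtn_eqF //.
have w_gen : w \in <<simple_transp>>%g.
  have [x _|] := pickP 'I_n; last first.
    move=> no; suff -> : w = 1%g by exact: group1.
    by apply/permP => i; have := no i.
  suff : <<[set tperm x y | y in 'I_n]%SET>>%g \subset <<simple_transp>>%g.
    by rewrite gen_tperm => /fintype.subsetP sub; apply: (sub w); rewrite inE.
  rewrite gen_subG; apply/fintype.subsetP => _ /imsetP[y _ ->].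
  have [xy|yx|/val_inj ->] := ltngtP x y; first exact: adj.
    by rewrite tpermC; exact: adj.
  by rewrite tperm1 group1.
have /gen_prodgP[k [c cS ->]] := w_gen.
exists k; elim: k c cS => [|k IH] c cS; first by rewrite big_ord0 expg0 set11.
by rewrite big_ord_recl expgS mem_mulg // IH.
Qed.

Definition coxeter_length w : nat := ex_minn (simple_transp_word w).

Definition bruhat_step u w : bool :=
  (coxeter_length u < coxeter_length w)%N
  && [exists a : 'I_n, exists b : 'I_n, w == perm_compose u (tperm a b)].

Definition bruhat_le : rel 'S_n := connect bruhat_step.

Definition bruhat_cover u w : bool :=
  [&& u != w, bruhat_le u w & coxeter_length w == (coxeter_length u).+1].

(* C lists all the elements u_0, ..., u_l of the chain, both ends included. *)
Definition saturated_chain v w C : bool :=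
  if C is u0 :: C' then [&& u0 == v, path bruhat_cover u0 C' & last u0 C' == w]
  else false.

Definition chain_graph C : rel 'I_n := fun a b =>
  [exists i : 'I_(size C).-1,
     nth 1%g C i.+1 == perm_compose (nth 1%g C i) (tperm a b)].

Definition opposite_diagram v : {set 'I_n * 'I_n} :=
  [set ij : 'I_n * 'I_n | (v ij.2 < ij.1)%N && (ij.2 < (v^-1)%g ij.1)%N]%SET.

End Permutations.

Section Cone.
Variable R : realType.
Variable n : nat.

Definition cone (S : set 'rV[R]_n) : set 'rV[R]_n :=
  [set x | exists k : nat, exists c : 'I_k -> R, exists u : 'I_k -> 'rV[R]_n,
     (forall i, 0 <= c i /\ S (u i)) /\ x = \sum_(i < k) c i *: u i].

Definition in_subspace_of_dim (E : set 'rV[R]_n) (k : nat) : bool :=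
  `[< exists2 U : {vspace 'rV[R]_n}, E `<=` [set` U] & \dim U = k >].

Lemma in_subspace_of_some_dim E : exists k, in_subspace_of_dim E k.
Proof.
exists (\dim {: 'rV[R]_n}); apply/asboolP.
by exists fullv => // x _ /=; rewrite memvf.
Qed.

Definition cone_dim (E : set 'rV[R]_n) : nat :=
  ex_minn (in_subspace_of_some_dim E).

Definition stdvec (i : 'I_n) : 'rV[R]_n := delta_mx 0 i.

Definition weight_cone (v w : 'S_n) : set 'rV[R]_n :=
  cone [set stdvec (v ij.2) - stdvec ij.1 | ij in
    [set ij | ij \in opposite_diagram v
      /\ bruhat_le (perm_compose (tperm (v ij.2) ij.1) v) w]].

End Cone.

Section KrullDimension.
Variables (R : realType) (T : topologicalType).
Implicit Types X Z : set T.

Definition irreducible Z : Prop :=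
  Z !=set0 /\ forall F G : set T, closed F -> closed G ->
    Z `<=` F `|` G -> Z `<=` F \/ Z `<=` G.

Definition closed_in X Z : Prop := exists2 F : set T, closed F & Z = X `&` F.

Definition irreducible_chain X (d : nat) : Prop :=
  exists Z : nat -> set T,
    (forall i, (i <= d)%N -> irreducible (Z i) /\ closed_in X (Z i))
    /\ (forall i, (i < d)%N -> Z i `<` Z i.+1).

Definition krull_dim X : \bar R :=
  ereal_sup [set (d%:R)%:E | d in irreducible_chain X].

End KrullDimension.

Section ZariskiTopology.
Variables (R : realType) (n : nat).

Definition GL : Type := {g : 'M[R[i]]_n | g \in unitmx}.
HB.instance Definition _ := SubChoice.on GL.

Definition mkGL (g : 'M[R[i]]_n) (ug : g \in unitmx) : GL := exist _ g ug.

Definition eval_entries (p : mpoly (n * n) R[i]) (g : GL) : R[i] :=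
  meval (fun k => mxvec (val g) 0 k) p.

(* As det is invertible on GL, the functions p(g) / det(g)^k define no further
   closed sets. *)
Definition zariski_open (U : set GL) : Prop :=
  exists P : set (mpoly (n * n) R[i]),
    U = [set g | exists2 p, P p & eval_entries p g != 0].

Lemma zariski_openT : zariski_open setT.
Proof.
exists [set (1 : mpoly (n * n) R[i])]; apply/seteqP; split=> // g _; exists 1 => //.
by rewrite /eval_entries meval1 oner_neq0.
Qed.

Lemma zariski_openI : setI_closed zariski_open.
Proof.
move=> _ _ [P ->] [Q ->].
exists [set p * q | p in P & q in Q].
apply/seteqP; split=> [g [[p Pp pg] [q Qq qg]]|g [_ [p Pp [q Qq <-]]]] /=.
  exists (p * q); first by exists p => //; exists q.
  by rewrite /eval_entries mevalM mulf_neq0.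
rewrite /eval_entries mevalM mulf_eq0 negb_or => /andP[pg qg].
by split; [exists p | exists q].
Qed.

Lemma zariski_open_bigU (I : Type) (f : I -> set GL) :
  (forall i, zariski_open (f i)) -> zariski_open (\bigcup_i f i).
Proof.
move=> /choice[P Pf]; exists (\bigcup_i P i).
apply/seteqP; split=> [g [i _]|g [p [i _ Pip] pg]].
  by rewrite Pf => -[p Pip pg]; exists p => //; exists i.
by exists i => //; rewrite Pf; exists p.
Qed.

HB.instance Definition _ :=
  isOpenTopological.Build GL zariski_openT zariski_openI zariski_open_bigU.

End ZariskiTopology.

Section FlagVariety.
Variables (R : realType) (n : nat).
Local Notation GL := (GL R n).

Definition borel_up : set GL :=
  [set g : GL | forall i j : 'I_n, (j < i)%N -> val g i j = 0].

Definition borel_low : set GL :=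
  [set g : GL | forall i j : 'I_n, (i < j)%N -> val g i j = 0].

Definition coset_up (g : GL) : set 'M[R[i]]_n :=
  [set val g *m val b | b in borel_up].

Definition same_coset (g h : GL) : bool := `[< coset_up g = coset_up h >].

Lemma same_coset_equiv : equiv_class_of same_coset.
Proof.
split=> [g|g h|h g k]; first exact/asboolP.
  by apply/asboolP/asboolP => ->.
by move=> /asboolP gh /asboolP hk; apply/asboolP; rewrite gh hk.
Qed.

Canonical same_coset_equivRel := EquivRelPack same_coset_equiv.

(* G/B, with the quotient of the Zariski topology of G. *)
Definition flag_variety : Type :=
  quotient_topology {eq_quot same_coset_equivRel}%qT.
HB.instance Definition _ := Topological.on flag_variety.
HB.instance Definition _ := Quotient.on flag_variety.

Definition flag_of (g : GL) : flag_variety := \pi_flag_variety g.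

Fact GLmul_subproof (g h : GL) : val g *m val h \in unitmx.
Proof. by rewrite unitmx_mul (valP g) (valP h). Qed.

Definition GLmul (g h : GL) : GL := mkGL (GLmul_subproof g h).

(* The matrix sending e_j to e_(w j): its entry (w j, j) is 1, whereas that of
   MathComp's perm_mx w is at (j, w j). *)
Fact GLperm_subproof (w : 'S_n) : (perm_mx w)^T \in @unitmx R[i] n.
Proof. by rewrite unitmx_tr unitmx_perm. Qed.

Definition GLperm (w : 'S_n) : GL := mkGL (GLperm_subproof w).

Definition schubert_cell (w : 'S_n) : set flag_variety :=
  [set flag_of (GLmul b (GLperm w)) | b in borel_up].

Definition opposite_cell (v : 'S_n) : set flag_variety :=
  [set flag_of (GLmul b (GLperm v)) | b in borel_low].

Definition kazhdan_lusztig_variety (v w : 'S_n) : set flag_variety :=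
  closure (schubert_cell w) `&` opposite_cell v.

Definition complexity (v w : 'S_n) : \bar R :=
  (krull_dim R (kazhdan_lusztig_variety v w)
   - (cone_dim (@weight_cone R n v w))%:R%:E)%E.

Definition kl_toric (v w : 'S_n) : Prop := complexity v w = 0%E.

End FlagVariety.

(* Main.v *)
From HB Require Import structures.
Require Import Defs.
From mathcomp Require Import all_boot all_order all_fingroup all_algebra.
From mathcomp Require Import complex zify ring.
From mathcomp Require Import -(notations) mpoly.
From mathcomp Require Import all_classical all_reals ereal topology.
Set Implicit Arguments.
Unset Strict Implicit.
Unset Printing Implicit Defensive.

Import Order.TTheory GRing.Theory Num.Theory.

(** Both sides of the criterion are numbers attached to [v <= w].  The dimension of
    [N_(v,w)] is [l(w) - l(v)].  The span of the weight cone is the span of the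
    differences [e_(v x) - e_(v (t x))] over the reflections [t] with
    [v < v t <= w]; these reflections generate the same group as the labels of any
    saturated chain from [v] to [w] (induction on [v], lifting chains along a simple
    reflection), so the dimension of the cone is the rank of the graph of the chain.
    Adding the cover [w' < w] raises the first number by one, and the second one
    exactly when the new edge joins two components.

    For the dimension, elimination writes a generic matrix [h] of the closure of
    [B w B] as [Y^-1 X v R], where [X v] lies in the slice of the opposite cell of
    [v], [Y] is unipotent upper triangular with [l(v)] free entries, and [R] is upper
    triangular; all factors are rational in [h].  This makes [N_(v,u)] irreducible, so
    that a saturated chain from [v] to [w] gives the lower bound.  For the upper
    bound, a chain of closed irreducible subsets of length [d] gives [d]
    algebraically independent functions on the slice; with the [l(v)] entries of [Y]
    they become independent rational functions on the cell of [w], an affine space of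
    dimension [l(w)], and counting monomials bounds their number by [l(w)]. *)

(** * Length and inversions *)

(** The labels of a chain depend on the chain and get conjugated when it is lifted, so they are
    compared through the group that they generate. Nothing is lost for the span, because the vectors
    [e_(v x) - e_(v (t x))] telescope along products.

    Krull dimension is given by chains of closed sets in a quotient topology, so the upper bound has
    to be carried to a space with explicit coordinates. [N_(v,w)] offers none, but the cell of [w]
    does, and on the translate [v B_- B] of the big cell the Schubert variety is the product of
    [N_(v,w)] with the [l(v)]-dimensional group of the matrices [Y]. This is why the entries of [Y]
    join the count: the slice functions alone would only give [d <= l(w)]. The factors [X] and [Y]
    depend on the flag of [h] only, so that functions of them can be evaluated on normal forms of
    cell points.

    Closures are common zero sets of the polynomials that vanish on an affine space of parameters.
    Irreducibility and density then reduce to one fact: polynomial functions over an infinite field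
    form a domain. *)

Section Inversions.
Variable n : nat.
Implicit Types (x y : 'S_n) (i j a b : 'I_n).

Definition inversions x : {set 'I_n * 'I_n} :=
  [set p : 'I_n * 'I_n | (p.1 < p.2)%N && (x p.2 < x p.1)%N]%SET.

Definition inv x : nat := #|inversions x|.

Lemma inv1 : inv 1%g = 0%N.
Proof.
apply/eqP; rewrite cards_eq0; apply/eqP/setP => p; rewrite !inE !perm1; lia.
Qed.

(* Swapping adjacent values only changes the status of the pair of positions that hold them. *)
Lemma inv_simple_asc x i j : (j == i.+1 :> nat) ->
  ((x^-1)%g i < (x^-1)%g j)%N -> inv (x * tperm i j)%g = (inv x).+1.
Proof.
move=> /eqP ij asc.
set p := ((x^-1)%g i, (x^-1)%g j).
have -> : inv (x * tperm i j)%g = #|p |: inversions x|%SET.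
  apply: eq_card => -[k l]; rewrite !inE /= !permM /p xpair_eqE.
  rewrite -(inj_eq (@perm_inj _ x) k) -(inj_eq (@perm_inj _ x) l) !permKV.
  have [kl|kl] /= := ltnP k l; last first.
    apply/esym/negbTE/negP; rewrite orbF => /andP[/eqP xk /eqP xl].
    by move: asc; rewrite -xk -xl !permK ltnNge kl.
  have nji : ~~ ((x k == j) && (x l == i)).
    apply/negP => /andP[/eqP xk /eqP xl].
    by move: asc; rewrite -xk -xl !permK ltnNge ltnW.
  have nkl : x k != x l by rewrite (inj_eq perm_inj) -val_eqE /= ltn_eqF.
  move: nji nkl; rewrite -!val_eqE /=.
  case: (tpermP i j (x k)) => [->|->|/eqP+ /eqP+];
  case: (tpermP i j (x l)) => [->|->|/eqP+ /eqP+]; rewrite -?val_eqE /=; lia.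
rewrite cardsU1 -[RHS]add1n; congr addn; rewrite -[RHS]/(nat_of_bool true).
by congr nat_of_bool; rewrite inE /= !permKV; lia.
Qed.

Lemma inv_simple_desc x i j : (j == i.+1 :> nat) ->
  ((x^-1)%g j < (x^-1)%g i)%N -> inv x = (inv (x * tperm i j)%g).+1.
Proof.
move=> ij desc; rewrite -(@inv_simple_asc (x * tperm i j)%g i j ij).
  by rewrite -mulgA tperm2 mulg1.
by rewrite invMg tpermV !permM tpermL tpermR.
Qed.

Lemma simple_transpP (t : 'S_n) :
  reflect (exists i, exists2 j : 'I_n, (j == i.+1 :> nat) & t = tperm i j)
          (t \in simple_transp n).
Proof.
rewrite inE; apply: (iffP existsP) => [[i /existsP[j /andP[ij /eqP ->]]]|[i [j ij ->]]].
  by exists i, j.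
by exists i; apply/existsP; exists j; rewrite ij eqxx.
Qed.

Lemma increasing_perm1 x :
  (forall i j, (j == i.+1 :> nat) -> ((x^-1)%g i < (x^-1)%g j)%N) -> x = 1%g.
Proof.
move=> asc; set y := (x^-1)%g; rewrite -(invgK x) -/y.
suff -> : y = 1%g by rewrite invg1.
have ge_id k (i : 'I_n) : i = k :> nat -> (i <= y i)%N.
  elim: k i => [|k IH] i ik; first by rewrite ik.
  have kn : (k < n)%N by have := ltn_ord i; lia.
  have /= := @asc (Ordinal kn) i; rewrite ik eqxx => /(_ isT).
  by have /= := IH (Ordinal kn) erefl; rewrite /y; lia.
have le_id k (i : 'I_n) : (n - i.+1)%N = k -> (y i <= i)%N.
  elim: k i => [|k IH] i ik; first by have := ltn_ord (y i); have := ltn_ord i; lia.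
  have kn : (i.+1 < n)%N by lia.
  have /= := @asc i (Ordinal kn); rewrite eqxx => /(_ isT).
  have kk : (n - (Ordinal kn).+1)%N = k by move: ik => /=; lia.
  by have /= := IH _ kk; rewrite /y; lia.
apply/permP => i; rewrite perm1; apply/val_inj/eqP.
by rewrite eqn_leq (le_id _ i erefl) (ge_id _ i erefl).
Qed.

Lemma exists_descent x : x <> 1%g ->
  exists i, exists2 j : 'I_n, (j == i.+1 :> nat) & ((x^-1)%g j < (x^-1)%g i)%N.
Proof.
move=> x1; apply: contrapT => no; apply: x1; apply: increasing_perm1 => i j ij.
rewrite ltnNge leq_eqVlt; apply/negP => /orP[/eqP/val_inj/perm_inj e|lt].
  by move: ij; rewrite e => /eqP; lia.
by apply: no; exists i, j.
Qed.

(** Sorting by adjacent swaps: each descent removed costs one letter and one inversion. For the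
    converse [inv_word], a letter raises [inv] by at most one. *)
Lemma word_inv x : x \in (simple_transp n ^+ inv x)%g.
Proof.
have [k] := ubnP (inv x); elim: k x => // k IH x /ltnSE.
have [->|/eqP/exists_descent[i [j ij desc]]] := eqVneq x 1%g.
  by rewrite inv1 expg0 set11.
rewrite (inv_simple_desc ij desc) expgSr => lt.
rewrite -{1}(mulgK (tperm i j) x) tpermV mem_mulg ?IH //.
by apply/simple_transpP; exists i, j.
Qed.

Lemma inv_word k x : x \in (simple_transp n ^+ k)%g -> (inv x <= k)%N.
Proof.
elim: k x => [|k IH] x; first by rewrite expg0 => /set1P ->; rewrite inv1.
rewrite expgSr => /mulsgP[y t /IH yk /simple_transpP[i [j ij ->]] ->].
have [|] := ltnP ((y^-1)%g i) ((y^-1)%g j).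
  by move/(inv_simple_asc ij) => ->.
rewrite leq_eqVlt => /orP[/eqP/val_inj/perm_inj e|].
  by rewrite e tperm1 mulg1 ltnW.
by move/(inv_simple_desc ij) => e; move: yk; rewrite e => /ltnW/leqW.
Qed.

Lemma coxeter_lengthE x : coxeter_length x = inv x.
Proof.
rewrite /coxeter_length; case: ex_minnP => k kx kmin.
by apply/eqP; rewrite eqn_leq kmin ?word_inv // inv_word.
Qed.

(** The map [phi] injects the inversions of [x] into those of [t * x] and misses [(a, b)]. A pair is
    moved by [t] if this keeps its order. Otherwise it consists of [a] or [b] and a position
    strictly between them, and [x a < x b] makes it an inversion of [t * x] as it stands. *)
Lemma inv_tperm_lt x a b : (a < b)%N -> (x a < x b)%N ->
  (inv x < inv (tperm a b * x)%g)%N.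
Proof.
move=> ab xab; set t := tperm a b.
pose phi (p : 'I_n * 'I_n) := if (t p.1 < t p.2)%N then (t p.1, t p.2) else p.
have phi_inj : {in inversions x &, injective phi}.
  move=> [k l] [k' l']; rewrite !inE /phi /= => /andP[kl _] /andP[kl' _].
  case: ifP => lt; case: ifP => lt'.
  - by move=> [/perm_inj -> /perm_inj ->].
  - by move=> [ek el]; move: lt'; rewrite -ek -el !tpermK kl.
  - by move=> [ek el]; move: lt; rewrite ek el !tpermK kl'.
  - by [].
rewrite /inv -(card_in_imset phi_inj); apply/proper_card/properP; split.
  apply/fintype.subsetP => _ /imsetP[[k l] + ->].
  rewrite !inE /phi /= => /andP[kl xlk]; case: ifP => /= lt.
    by rewrite lt !permM !tpermK xlk.
  rewrite kl !permM; move: lt kl xlk.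
  rewrite -/t; case: (tpermP a b k) => [->|->|/eqP+ /eqP+];
  case: (tpermP a b l) => [->|->|/eqP+ /eqP+]; rewrite -?val_eqE /=; lia.
exists (a, b); first by rewrite inE /= ab !permM tpermL tpermR.
apply/imsetP => -[[k l]]; rewrite inE /phi /= => /andP[kl xlk].
case: ifP => lt [ak bl]; last by move: xlk; rewrite -ak -bl; lia.
by move: kl; rewrite -(tpermK a b k) -(tpermK a b l) -/t -ak -bl tpermL tpermR; lia.
Qed.

Lemma inv_tpermP x a b : (a < b)%N ->
  (inv x < inv (tperm a b * x)%g)%N = (x a < x b)%N.
Proof.
move=> ab; apply/idP/idP; last exact: inv_tperm_lt.
apply: contraLR; rewrite -!leqNgt leq_eqVlt => /orP[/eqP/val_inj/perm_inj e|lt].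
  by rewrite e ltnn in ab.
rewrite ltnW // -{2}(mulKg (tperm a b) x) tpermV; apply: inv_tperm_lt => //.
by rewrite !permM tpermL tpermR.
Qed.

End Inversions.

(** * Bruhat order and lifting of chains *)

Section Lifting.
Variable n : nat.
Implicit Types (x y z t w : 'S_n) (a b : 'I_n) (L : seq 'S_n).

Lemma bruhat_stepP x y :
  reflect ((inv x < inv y)%N /\ exists a b, y = (tperm a b * x)%g) (bruhat_step x y).
Proof.
rewrite /bruhat_step !coxeter_lengthE; apply: (iffP andP) => -[lt].
  by move=> /existsP[a /existsP[b /eqP yE]]; split=> //; exists a, b.
move=> [a [b yE]]; split=> //; rewrite yE.
by apply/existsP; exists a; apply/existsP; exists b.
Qed.

Lemma bruhat_step_tperm x t : bruhat_step x (t * x)%g ->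
  exists a b, [/\ t = tperm a b, (a < b)%N & (x a < x b)%N].
Proof.
move=> /bruhat_stepP[lt [a [b /mulIg tE]]].
have [ab|ba|/val_inj ab] := ltngtP a b.
- by exists a, b; rewrite tE; split=> //; rewrite -inv_tpermP // -tE.
- by exists b, a; rewrite tpermC; split=> //; rewrite -inv_tpermP // tpermC -tE.
- by move: lt; rewrite tE ab tperm1 mul1g ltnn.
Qed.

Lemma bruhat_step_of_lt x a b : (a < b)%N -> (x a < x b)%N ->
  bruhat_step x (tperm a b * x)%g.
Proof.
by move=> ab xab; apply/bruhat_stepP; rewrite inv_tpermP //; split=> //; exists a, b.
Qed.

Lemma bruhat_le_inv x y : bruhat_le x y -> (inv x <= inv y)%N.
Proof.
move=> /connectP[p]; elim: p x => [|z p IH] x /=; first by move=> _ ->.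
move=> /andP[/bruhat_stepP[lt _] /IH{}IH] /IH; lia.
Qed.

Lemma bruhat_le_refl x : bruhat_le x x. Proof. exact: connect0. Qed.

Lemma bruhat_le_trans y x z : bruhat_le x y -> bruhat_le y z -> bruhat_le x z.
Proof. exact: connect_trans. Qed.

Lemma bruhat_le_anti x y : bruhat_le x y -> inv x = inv y -> x = y.
Proof.
move=> /connectP[[|z p] /=]; first by move=> _ ->.
move=> /andP[/bruhat_stepP[lt _] pz] yE e.
have : bruhat_le z y by apply/connectP; exists p.
move/bruhat_le_inv; lia.
Qed.

(* The labels [t] of a saturated chain, each element being [t * x] for the
   preceding one [x]; in the notation of the paper this is [x t],
   so the labels are transpositions of positions. *)
Inductive label_chain : 'S_n -> 'S_n -> seq 'S_n -> Prop :=
| label_chain_nil x : label_chain x x [::]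
| label_chain_cons x t y L : (exists a b, t = tperm a b) ->
    inv (t * x)%g = (inv x).+1 -> label_chain (t * x)%g y L ->
    label_chain x y (t :: L).

Lemma label_chain_rcons x y L t : (exists a b, t = tperm a b) ->
  inv (t * y)%g = (inv y).+1 -> label_chain x y L ->
  label_chain x (t * y)%g (rcons L t).
Proof.
move=> ht hy C; elim: C ht hy => {x y L} /= [x|x u y L hu iu C IH] ht hy.
  by apply: label_chain_cons => //; exact: label_chain_nil.
by apply: label_chain_cons => //; exact: IH.
Qed.

(** The group, unlike the set of labels, is insensitive to the conjugations and reorderings that
    lifting a chain produces. *)
Definition label_group L : {group 'S_n} := <<[set t in L]>>%G.

Lemma mem_label_group L t : t \in L -> t \in label_group L.
Proof. by move=> tL; rewrite mem_gen // inE. Qed.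

Lemma label_group_sub L (H : {group 'S_n}) :
  {subset L <= H} -> label_group L \subset H.
Proof.
by move=> sub; rewrite gen_subG; apply/fintype.subsetP => t; rewrite inE => /sub.
Qed.

Lemma eq_label_group L L' : {subset L <= label_group L'} ->
  {subset L' <= label_group L} -> label_group L = label_group L'.
Proof.
by move=> s s'; apply/group_inj/setP/subset_eqP; rewrite !label_group_sub.
Qed.

Lemma label_group_consr L t : label_group L \subset label_group (t :: L).
Proof.
by apply: label_group_sub => u uL; rewrite mem_label_group // inE uL orbT.
Qed.

Lemma label_group_cons_eq t t' L L' :
  t \in label_group (t' :: L') -> t' \in label_group (t :: L) ->
  label_group L = label_group L' ->
  label_group (t :: L) = label_group (t' :: L').
Proof.
move=> tt' t't e; apply: eq_label_group => u; rewrite inE => /orP[/eqP -> //|uL].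
  by apply: (fintype.subsetP (label_group_consr _ _)); rewrite -e mem_label_group.
by apply: (fintype.subsetP (label_group_consr _ _)); rewrite e mem_label_group.
Qed.

Lemma label_group_cons t L L' : label_group L = label_group L' ->
  label_group (t :: L) = label_group (t :: L').
Proof. by apply: label_group_cons_eq; rewrite mem_label_group // mem_head. Qed.

Lemma label_group_swap t u L : label_group [:: t, u & L] = label_group [:: u, t & L].
Proof.
by apply: eq_label_group => z zL; apply: mem_label_group; move: zL; rewrite !inE orbCA.
Qed.

Lemma label_group_conj t u L :
  label_group [:: (u ^ t)%g, t & L] = label_group [:: u, t & L].
Proof.
have ht c : t \in label_group [:: c, t & L] by rewrite mem_label_group // !inE eqxx orbT.
have hd c : c \in label_group [:: c, t & L] by rewrite mem_label_group // mem_head.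
apply: label_group_cons_eq => //; first by rewrite memJ_norm ?hd // (fintype.subsetP (normG _)) ?ht.
by rewrite -(memJ_norm _ (fintype.subsetP (normG _) _ (ht _))) hd.
Qed.

(** * Lifting along a simple reflection *)

Section SimpleReflection.
Variables i j : 'I_n.
Hypothesis ij : (j == i.+1 :> nat).
Let s := tperm i j.

(** In the usual order of composition this is the condition [s x > x]. *)
Definition ascent x : bool := ((x^-1)%g i < (x^-1)%g j)%N.

Lemma simple_neq : i != j. Proof. by rewrite -val_eqE /= (eqP ij); lia. Qed.

Lemma ascent_mul x : ascent (x * s)%g = ~~ ascent x.
Proof.
rewrite /ascent invMg tpermV !permM tpermL tpermR.
have : (x^-1)%g i != (x^-1)%g j by rewrite (inj_eq perm_inj) simple_neq.
rewrite -val_eqE -leqNgt /= => ne; apply/idP/idP; first exact: ltnW.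
by rewrite leq_eqVlt eq_sym (negbTE ne).
Qed.

Lemma mulss x : (x * s * s)%g = x. Proof. by rewrite -mulgA tperm2 mulg1. Qed.

Lemma inv_asc x : ascent x -> inv (x * s)%g = (inv x).+1.
Proof. exact: inv_simple_asc. Qed.

Lemma inv_desc x : ~~ ascent x -> inv x = (inv (x * s)%g).+1.
Proof. by rewrite -ascent_mul => /inv_asc; rewrite mulss. Qed.

(* [s x = x T] in the notation of the paper: the transposition of the positions that
   hold the values [i] and [j]. *)
Definition position_reflection x : 'S_n := tperm ((x^-1)%g i) ((x^-1)%g j).
Local Notation T := position_reflection.

Lemma position_reflectionE x : T x = (x * s * x^-1)%g.
Proof. by rewrite /T -tpermJ conjgE invgK mulgA. Qed.

Lemma position_reflection_mul x : (T x * x)%g = (x * s)%g.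
Proof. by rewrite position_reflectionE mulgKV. Qed.

Lemma position_reflection_conj t x : T (t * x)%g = (T x ^ t^-1)%g.
Proof. by rewrite !position_reflectionE conjgE invgK invMg !mulgA. Qed.

Lemma bruhat_step_asc x : ascent x -> bruhat_step x (x * s)%g.
Proof.
move=> ax; rewrite -position_reflection_mul; apply: bruhat_step_of_lt => //.
by rewrite !permKV (eqP ij).
Qed.

(** The same two positions are exchanged in both steps. Swapping the adjacent values [i] and [j]
    reverses the order of two values only if these are [i] and [j] themselves, which is the excluded
    case [y = x * s]. *)
Lemma bruhat_step_mul x y : bruhat_step x y -> y <> (x * s)%g ->
  bruhat_step (x * s)%g (y * s)%g.
Proof.
rewrite -{1}(mulgKV x y) => /bruhat_step_tperm[a [b [tE ab xab]]] ys.
have -> : (y * s = tperm a b * (x * s))%g by rewrite -tE -mulgA mulKg.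
have {}ys : ~ (x a = i /\ x b = j).
  case=> xa xb; apply: ys; rewrite -(mulgKV x y) tE /s -xa -xb.
  by rewrite -tpermJ conjgE mulKVg.
apply: bruhat_step_of_lt => //; rewrite !permM /s; move: xab ys.
case: (tpermP i j (x a)) => [->|->|/eqP+ /eqP+];
case: (tpermP i j (x b)) => [->|->|/eqP+ /eqP+];
rewrite -?val_eqE /= ?(eqP ij); try lia.
by move=> _ /(_ (conj erefl erefl)).
Qed.

(** The larger and the smaller element of the coset of [x] modulo [s]. Both maps are monotone for
    the Bruhat order, which is the lifting property. *)
Definition lift_up x : 'S_n := if ascent x then (x * s)%g else x.
Definition lift_dn x : 'S_n := if ascent x then x else (x * s)%g.

Lemma lift_up_le x y : bruhat_le x y -> bruhat_le (lift_up x) (lift_up y).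
Proof.
move=> /connectP[p]; elim: p x => [|z p IH] x /=; first by move=> _ ->; exact: connect0.
move=> /andP[xz pz] yE; apply: bruhat_le_trans (IH _ pz yE) => {p IH y pz yE}.
rewrite /lift_up; case: ifP => ax; case: ifP => az.
- apply/connect1/bruhat_step_mul => // e.
  by move: az; rewrite e ascent_mul ax.
- have [->|/eqP zs] := eqVneq z (x * s)%g; first exact: connect0.
  apply: (@bruhat_le_trans (z * s)%g); first exact/connect1/bruhat_step_mul.
  have az' : ascent (z * s)%g by rewrite ascent_mul az.
  by have := bruhat_step_asc az'; rewrite mulss => /connect1.
- apply: (bruhat_le_trans (connect1 xz)).
  exact/connect1/bruhat_step_asc.
- exact: connect1.
Qed.

Lemma lift_dn_le x y : bruhat_le x y -> bruhat_le (lift_dn x) (lift_dn y).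
Proof.
move=> /connectP[p]; elim: p x => [|z p IH] x /=; first by move=> _ ->; exact: connect0.
move=> /andP[xz pz] yE; apply: bruhat_le_trans (IH _ pz yE) => {p IH y pz yE}.
rewrite /lift_dn; case: ifP => ax; case: ifP => az.
- exact: connect1.
- have [->|/eqP zs] := eqVneq z (x * s)%g; first by rewrite mulss; exact: connect0.
  apply: (@bruhat_le_trans (x * s)%g); first exact/connect1/bruhat_step_asc.
  exact/connect1/bruhat_step_mul.
- apply: bruhat_le_trans (connect1 xz).
  have ax' : ascent (x * s)%g by rewrite ascent_mul ax.
  by have := bruhat_step_asc ax'; rewrite mulss => /connect1.
- apply/connect1/bruhat_step_mul => // e.
  by move: az; rewrite e ascent_mul ax.
Qed.

(** Each element of the chain is replaced by the larger element of its coset. When one end is an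
    ascent and the other is not, the lengths of the two chains differ by one, and [T x] makes up for
    the missing label of the shorter one. The choice of [x] in [T x] is harmless: along the chain
    [T] changes by conjugation with labels. *)
Lemma label_chain_lift x y L : label_chain x y L ->
  exists2 L', label_chain (lift_up x) (lift_up y) L' &
    label_group (if ascent x && ~~ ascent y then T x :: L' else L')
    = label_group (if ~~ ascent x && ascent y then T x :: L else L).
Proof.
elim=> {x y L} [x|x t y L [a [b tE]] it C [L' C' e]].
  exists [::]; first exact: label_chain_nil.
  by rewrite andbN andNb.
have Tz : T x = (T (t * x)%g ^ t)%g by rewrite position_reflection_conj conjgKV.
have conjT M : label_group [:: T x, t & M] = label_group [:: T (t * x)%g, t & M].
  by rewrite Tz label_group_conj.
have xz : bruhat_step x (t * x)%g.
  by apply/bruhat_stepP; rewrite it; split=> //; exists a, b; rewrite tE.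
have {}tE : exists a b, t = tperm a b by exists a, b.
move: C' e; rewrite /lift_up; case: (boolP (ascent x)) => ax;
  case: (boolP (ascent (t * x)%g)) => az /= C' e.
- exists (t :: L').
    apply: label_chain_cons => //; last by rewrite mulgA.
    by rewrite mulgA !inv_asc // it.
  case: ifP e => ay /=; move=> e; last exact: label_group_cons.
  by rewrite conjT label_group_swap; exact: label_group_cons.
(* Otherwise [x * s] to [t * x * s] would be a step, although the first has length [inv x + 1] and
   the second [inv x]. *)
- have zs : (t * x = x * s)%g.
    apply: contrapT => zs; have /bruhat_stepP[] := bruhat_step_mul xz zs.
    rewrite inv_asc //; have /inv_desc := az; rewrite it => ->; lia.
  have tT : t = T x by apply: (mulIg x); rewrite zs position_reflection_mul.
  have Tzt : T (t * x)%g = t by rewrite position_reflection_conj -tT conjgE invgK mulgV mulg1.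
  exists L'; first by rewrite -zs.
  case: (ascent y) C' e => C' /= e; first by rewrite e Tzt.
  by rewrite -tT; exact: label_group_cons.
(* Lifting fixes [x] and raises [t * x], so the two images differ by two in length; the new chain
   goes through [t * x]. *)
- exists [:: t, T (t * x)%g & L'].
    apply: label_chain_cons => //; apply: label_chain_cons; first by do 2 eexists.
      by rewrite position_reflection_mul inv_asc.
    by rewrite position_reflection_mul.
  case: (ascent y) C' e => C' /=  e.
    by rewrite conjT label_group_swap; do 2 apply: label_group_cons.
  exact: label_group_cons.
- exists (t :: L'); first exact: label_chain_cons.
  case: (ascent y) C' e => C' /= e; last exact: label_group_cons.
  by rewrite conjT label_group_swap; exact: label_group_cons.
Qed.

End SimpleReflection.

(** Steps of the Bruhat order may raise the length by more than one, so covers have to be produced.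
    With a descent [s] of [y], the induction gives a chain up to [y * s]: it is prolonged by one
    step if it starts at [x], and lifted if it starts at [x * s]. *)
Lemma exists_label_chain x y : bruhat_le x y -> exists L, label_chain x y L.
Proof.
have [k] := ubnP (inv y); elim: k x y => // k IH x y /ltnSE yk le_xy.
have [y1|/eqP/exists_descent[i [j ij desc]]] := eqVneq y 1%g.
  exists [::]; have -> : x = y; last exact: label_chain_nil.
  by apply: bruhat_le_anti => //; have := bruhat_le_inv le_xy; rewrite y1 inv1; lia.
set s := tperm i j.
have ay : ~~ ascent i j y by rewrite /ascent -leqNgt ltnW.
have iy := inv_desc ij ay.
have := lift_dn_le ij le_xy; rewrite /lift_dn (negbTE ay); case: ifP => ax le.
  have [|L C] := IH _ _ _ le; first by rewrite -/s in iy *; lia.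
  exists (rcons L (position_reflection i j (y * s)%g)).
  have := position_reflection_mul i j (y * s)%g; rewrite mulss => {1}<-.
  apply: label_chain_rcons => //; first by do 2 eexists.
  by rewrite position_reflection_mul mulss.
have [|L C] := IH _ _ _ le; first by rewrite -/s in iy *; lia.
have [L' C' _] := label_chain_lift ij C; exists L'.
by move: C'; rewrite /lift_up !ascent_mul // ax (negbTE ay) !mulss.
Qed.

End Lifting.

(** * Chain labels and upward reflections *)

Section UpwardReflections.
Variable n : nat.
Implicit Types (x y v w t : 'S_n) (L : seq 'S_n).

Definition up_reflections v w : {set 'S_n} :=
  [set t : 'S_n | bruhat_step v (t * v)%g && bruhat_le (t * v)%g w]%SET.

Lemma no_ascent_decreasing x : 
  (forall i j : 'I_n, (j == i.+1 :> nat) -> ~~ ascent i j x) ->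
  forall i j : 'I_n, (i < j)%N -> ((x^-1)%g j < (x^-1)%g i)%N.
Proof.
move=> desc i [m]; elim: m => [|m IH] // mn /= im.
have mn' : (m < n)%N by exact: ltnW.
have := desc (Ordinal mn') (Ordinal mn) (eqxx _).
rewrite /ascent -leqNgt leq_eqVlt => /orP[/eqP/val_inj/perm_inj/(congr1 val) /=|]; first by lia.
move=> lt; have [im'|] := ltnP i m; first exact: ltn_trans (IH mn' im').
by move=> mi; have -> : i = Ordinal mn' by apply/val_inj/eqP; rewrite eqn_leq mi andbT.
Qed.

Lemma inv_bound x : (inv x <= n * n)%N.
Proof. by rewrite /inv (leq_trans (max_card _)) // card_prod card_ord. Qed.

(** A permutation without ascents reverses the order, and no transposition raises its length. *)
Lemma exists_ascent v t : bruhat_step v (t * v)%g ->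
  exists i j : 'I_n, (j == i.+1 :> nat) /\ ascent i j v.
Proof.
move=> /bruhat_step_tperm[a [b [_ ab vab]]].
apply: contrapT => no; have desc (i j : 'I_n) : (j == i.+1 :> nat) -> ~~ ascent i j v.
  by move=> ij; apply/negP => asc; apply: no; exists i, j.
by have := no_ascent_decreasing desc vab; rewrite !permK ltnNge ltnW.
Qed.

(* The critical case of the induction below: [v], [v s], [t v s], [t v] lie in one
   coset of a parabolic subgroup of type S_3, whose third reflection is
   conjugate to [t]. *)
Lemma critical_reflection v t (i j : 'I_n) : (j == i.+1 :> nat) ->
  ascent i j v -> bruhat_step v (t * v)%g -> ~~ ascent i j (t * v)%g ->
  t <> position_reflection i j v ->
  let u := (t ^ position_reflection i j v)%g in
  bruhat_step v (u * v)%g /\ bruhat_step (u * v)%g (t * (v * tperm i j))%g.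
Proof.
move=> ij asc /bruhat_step_tperm[a [b [-> ab vab]]] desc nT.
set T := position_reflection i j v; set c := (v^-1)%g i; set d := (v^-1)%g j.
have TE : T = tperm c d by [].
have vc : v c = i by rewrite permKV.
have vd : v d = j by rewrite permKV.
have cd : (c < d)%N by [].
have jE : j = i.+1 :> nat by apply/eqP.
have uE : (tperm a b ^ T)%g = tperm (T a) (T b) by rewrite tpermJ.
have -> : (tperm a b * (v * tperm i j) = T * (tperm (T a) (T b) * v))%g.
  by rewrite -uE conjgE -position_reflection_mul -/T -!mulgA mulKVg.
rewrite uE TE.
have {}desc : (tperm a b d < tperm a b c)%N.
  move: desc; rewrite /ascent invMg tpermV !permM -/c -/d -leqNgt leq_eqVlt.
  by case/orP => // /eqP/val_inj/perm_inj e; move: cd; rewrite e ltnn.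
have {}nT : ~ (a = c /\ b = d) by case=> ac bd; apply: nT; rewrite -/T TE ac bd.
clearbody c d.
(* The transposition reverses the order of [c < d] without exchanging them, so it moves exactly one
   of them; the inequalities leave two possibilities. *)
have cases : (a = c /\ (d < b)%N) \/ (b = d /\ (a < c)%N).
  move: desc nT; case: (tpermP a b c) => [ca|cb|/eqP+ /eqP+];
  case: (tpermP a b d) => [da|db|/eqP+ /eqP+];
  rewrite -?val_eqE /=; (try subst c); (try subst d); try lia.
  - by move=> _ [].
  - by left.
  - by move=> *; right.
case: cases => [[ac db]|[bd ac]].
- have bc : b != c by rewrite -val_eqE /=; lia.
  have bd : b != d by rewrite -val_eqE /=; lia.
  have vbd : v b != v d by rewrite (inj_eq perm_inj).
  rewrite ac tpermL tpermD 1?eq_sym //.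
  split; apply: bruhat_step_of_lt => //.
    by move: vbd vab; rewrite ac vd vc -val_eqE /=; lia.
  rewrite !permM tpermL tpermD ?(eq_sym d) // 1?eq_sym //.
    by rewrite vc -{1}vc -ac.
  by rewrite -val_eqE /=; lia.
- have ac' : a != c by rewrite -val_eqE /=; lia.
  have ad : a != d by rewrite -val_eqE /=; lia.
  have vac : v a != v c by rewrite (inj_eq perm_inj).
  rewrite bd tpermR tpermD 1?eq_sym //.
  split; apply: bruhat_step_of_lt => //.
    by move: vac vab; rewrite bd vd vc -val_eqE /=; lia.
  rewrite !permM tpermR tpermD // 1?eq_sym ?neq_ltn ?cd //.
    by move: vab; rewrite bd.
  by rewrite orbT.
Qed.

(** Descending induction on [v], replaced by [v * s] at an ascent [s]. A reflection [t] other than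
    [T v] is upward at [v] exactly when it is at [v * s], so only the bounds by [w] and the
    reflection [T v] have to be compared, according to whether [s] is an ascent of [w]. *)
Lemma label_group_up_reflections v w L : label_chain v w L ->
  label_group L = <<up_reflections v w>>%G.
Proof.
have [k] := ubnP (n * n - inv v)%N; elim: k v w L => // k IH v w L /ltnSE vk C.
have [vw|nvw] := eqVneq v w.
  have -> : L = [::].
    case: C vw vk => // x t y M _ it C xy _.
    have : bruhat_le (t * x)%g y.
      elim: C {xy it} => {}x; first by move=> *; exact: bruhat_le_refl.
      move=> u z N [a [b uE]] iu _; apply: bruhat_le_trans; apply: connect1.
      by apply/bruhat_stepP; rewrite iu; split=> //; exists a, b; rewrite uE.
    by move/bruhat_le_inv; rewrite it xy ltnn.
  apply: group_inj; congr <<_>>%g; apply/setP => t; rewrite !inE; apply/esym/negbTE.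
  rewrite -vw; apply/negP => /andP[/bruhat_stepP[lt _] /bruhat_le_inv]; lia.
have [i [j [ij av]]] : exists i j : 'I_n, (j == i.+1 :> nat) /\ ascent i j v.
  case: C nvw => [x|x t y M tE it _ _]; first by rewrite eqxx.
  apply: (@exists_ascent x t); apply/bruhat_stepP; rewrite it; split=> //.
  by have [a [b ->]] := tE; exists a, b.
set s := tperm i j; set T := position_reflection i j.
have ss x : (x * s * s = x)%g := mulss i j x.
have iv : inv (v * s)%g = (inv v).+1 := inv_asc ij av.
have TvE : (T v * v = v * s)%g := position_reflection_mul i j v.
have IHs w' M : label_chain (v * s)%g w' M -> label_group M = <<up_reflections (v * s) w'>>%G.
  by apply: IH; have := inv_bound (v * s)%g; lia.
have stepv : bruhat_step v (v * s)%g := bruhat_step_asc ij av.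
have nTs t : bruhat_step v (t * v)%g -> t <> T v -> bruhat_step (v * s)%g (t * v * s)%g.
  move=> st tT; apply: bruhat_step_mul => // e; apply: tT.
  by apply: (mulIg v); rewrite TvE.
have nTs' t : bruhat_step (v * s)%g (t * (v * s))%g -> bruhat_step v (t * v)%g /\ t <> T v.
  move=> st; have tT : t <> T v.
    move=> tT; move: st; rewrite tT mulgA TvE ss => /bruhat_stepP[]; by rewrite iv ltnNge leqnSn.
  split=> //; have := bruhat_step_mul ij st.
  rewrite -/s ss !mulgA ss; apply => e; apply: tT.
  by apply: (mulIg v); rewrite TvE -(ss (t * v)%g) e.
have [L' C' e] := label_chain_lift ij C.
move: C' e; rewrite /lift_up av /= -/s; have [aw|dw] := boolP (ascent i j w) => C' e.
  rewrite -e; have L'E := IHs _ _ C'; rewrite L'E.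
  apply/group_inj/setP/subset_eqP/andP; split; rewrite /= gen_subG; last first.
    apply/fintype.subsetP => t; rewrite inE => /andP[st tw].
    have [tT|/eqP tT] := eqVneq t (T v); last first.
      apply: mem_gen; rewrite inE mulgA nTs //=.
      have := lift_up_le ij tw; rewrite /lift_up aw -/s; case: ifP => // at' le.
      have st' := nTs _ st tT; apply: bruhat_le_trans le.
      have : ascent i j (t * v * s)%g by rewrite ascent_mul // at'.
      by move/(bruhat_step_asc ij)/connect1; rewrite ss.
    (* The reflection [T v] leads down from [v * s], so it is reached through the group: a chain
       from [v * s] to [w] lifts to one from [v * s] to [w * s], whose group contains
       [T (v * s) = T v]. *)
    have [D CD] : exists D, label_chain (v * s)%g w D.
      by apply: exists_label_chain; rewrite -TvE -tT.
    have [D' CD' eD] := label_chain_lift ij CD.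
    have avs : ascent i j (v * s) = false by rewrite ascent_mul // av.
    move: CD' eD; rewrite /lift_up avs aw /= => CD' eD.
    have := IHs _ _ CD' => /(congr1 val) /= <-.
    have -> : <<[set z in D']>>%g = label_group D' by [].
    rewrite eD -/T mem_label_group // tT; suff -> : T (v * s)%g = T v by rewrite mem_head.
    by rewrite /T !position_reflectionE invMg tpermV -/s !mulgA ss.
  apply/fintype.subsetP => t; rewrite inE => /andP[st tw].
  have [st' tT] := nTs' _ st.
  have := lift_dn_le ij tw; rewrite /lift_dn [ascent i j (w * s)]ascent_mul // aw /=.
  rewrite ss mulgA ascent_mul //; case: ifP => at' le; last first.
    by apply: mem_gen; rewrite inE st' /=; move: le; rewrite ss.
  (* Here [t * v * s <= w] is known, but [t * v <= w] may fail. The reflections [T v] and [t ^ T v]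
     are upward and stay below [w], and they generate [t]. *)
  have [u1 u2] := critical_reflection ij av st' at' tT.
  have uin : (t ^ T v)%g \in <<up_reflections v w>>%g.
    by apply: mem_gen; rewrite inE u1 (bruhat_le_trans (connect1 u2)) // mulgA.
  have Tin : T v \in <<up_reflections v w>>%g.
    apply: mem_gen; rewrite inE TvE stepv /= (bruhat_le_trans (connect1 st)) //.
    by rewrite mulgA.
  by rewrite -(conjgK (T v) t) groupJ // groupV.
rewrite -e; have L'E := IHs _ _ C'.
apply/group_inj/setP/subset_eqP/andP; split; rewrite /= gen_subG; last first.
  apply/fintype.subsetP => t; rewrite inE => /andP[st tw].
  have [tT|/eqP tT] := eqVneq t (T v).
    by rewrite tT (@mem_label_group _ (T v :: L')) ?mem_head.
  apply: (fintype.subsetP (label_group_consr _ _)); rewrite L'E.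
  apply: mem_gen; rewrite inE mulgA nTs //=.
  have := lift_up_le ij tw; rewrite /lift_up (negbTE dw) -/s; case: ifP => // at' le.
  apply: bruhat_le_trans le.
  have : ascent i j (t * v * s)%g by rewrite ascent_mul // at'.
  by move/(bruhat_step_asc ij)/connect1; rewrite ss.
have vsw : bruhat_le (v * s)%g w.
  have le : bruhat_le v w.
    elim: C {vk nvw av iv TvE IHs stepv nTs nTs' C' e dw L'E} => {}v; first exact: bruhat_le_refl.
    move=> t y M [a [b tE]] it _; apply: bruhat_le_trans; apply: connect1.
    by apply/bruhat_stepP; rewrite it; split=> //; exists a, b; rewrite tE.
  by have := lift_up_le ij le; rewrite /lift_up av (negbTE dw).
apply/fintype.subsetP => t; rewrite inE inE => /orP[/eqP ->|tL'].
  by apply: mem_gen; rewrite inE TvE stepv.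
have : t \in label_group L' by exact: mem_label_group.
rewrite L'E; apply/fintype.subsetP; rewrite gen_subG; apply/fintype.subsetP => {tL'}t.
rewrite inE => /andP[st tw]; apply: mem_gen; have [st' tT] := nTs' _ st.
rewrite inE st' /=.
have := lift_up_le ij tw; rewrite /lift_up (negbTE dw) mulgA ascent_mul //.
case: ifP => at' le; first by move: le; rewrite ss.
apply: bruhat_le_trans le; have := bruhat_step_asc ij (negbFE at').
by move/connect1.
Qed.

End UpwardReflections.

(** * Dimension of the weight cone *)

Section ConeDimension.
Variables (R : realType) (n : nat).
Implicit Types (v w t : 'S_n) (L C : seq 'S_n) (U : {vspace 'rV[R]_n}).
Local Open Scope ring_scope.

(** Letting [x] range over all points avoids choosing the two points that [t] exchanges: the fixed
    points contribute zero. *)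
Definition edge_vectors v L : seq 'rV[R]_n :=
  [seq stdvec R (v x) - stdvec R (v (t x)) | t : 'S_n <- L, x <- enum 'I_n].

Lemma edge_vectorsP v L U :
  (forall t x, t \in L -> stdvec R (v x) - stdvec R (v (t x)) \in U) <->
  (<<edge_vectors v L>> <= U)%VS.
Proof.
split=> [sub|/span_subvP sub t x tL].
  by apply/span_subvP => _ /allpairsP[[t x] /= [tL _ ->]]; exact: sub.
by apply: sub; apply/allpairsP; exists (t, x); rewrite /= mem_enum.
Qed.

(** Telescoping along a word in the generators; hence the span depends on the generated group
    only. *)
Lemma edge_vectors_group v U (S : {set 'S_n}) :
  (forall t x, t \in S -> stdvec R (v x) - stdvec R (v (t x)) \in U) ->
  forall t x, t \in <<S>>%g -> stdvec R (v x) - stdvec R (v (t x)) \in U.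
Proof.
move=> sub t x tS.
have := gen_prodgP tS; move=> [k [c cS ->]] {t tS}.
elim: k c cS x => [|k IH] c cS x.
  by rewrite big_ord0 perm1 subrr mem0v.
rewrite big_ord_recl permM -(subrKA (stdvec R (v (c ord0 x)))) rpredD //.
  exact: sub.
by apply: IH => i; exact: cS.
Qed.

Lemma cone_subset U (S : set 'rV[R]_n) :
  (cone S `<=` [set` U])%classic <-> (S `<=` [set` U])%classic.
Proof.
split=> sub x.
  move=> Sx; apply: sub; exists 1%N, (fun=> 1), (fun=> x); split.
    by move=> _; split=> //; exact: ler01.
  by rewrite big_ord1 scale1r.
move=> [k [c [u [cu ->]]]]; apply: rpred_sum => i _; apply: rpredZ.
by apply: sub; have [] := cu i.
Qed.

(** Put [b = v^-1 i]. A pair [(i, j)] of the diagram is a pair of positions [j < b] with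
    [v j < v b], and exchanging the values [v j] and [i] amounts to exchanging these positions. The
    generators of the cone are thus the edge vectors of the upward reflections, up to sign and
    zero. *)
Lemma weight_cone_subset v w U :
  (@weight_cone R n v w `<=` [set` U])%classic <->
  (forall t x, t \in up_reflections v w ->
     stdvec R (v x) - stdvec R (v (t x)) \in U).
Proof.
rewrite cone_subset; split=> [sub t x|sub x [[i j] [/= + le] <-]].
  rewrite inE => /andP[/bruhat_step_tperm[a [b [tE ab vab]]] tw].
  have mem : stdvec R (v a) - stdvec R (v b) \in U.
    apply: (sub _); exists (v b, a) => //=; split.
      by rewrite inE /= permK vab.
    rewrite /perm_compose; suff -> : (v * tperm (v a) (v b) = t * v)%g by [].
    by rewrite tE -tpermJ conjgE mulKVg.
  rewrite tE; case: tpermP => [->|->|_ _] //; last by rewrite subrr mem0v.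
  by rewrite -opprB rpredN.
rewrite inE /= => /andP[vji jvi].
set b := (v^-1)%g i; have vb : v b = i by rewrite permKV.
rewrite /= -vb -[in X in _ - stdvec R (v X)](tpermL j b); apply: sub; rewrite inE.
rewrite bruhat_step_of_lt ?vb //=; move: le; rewrite /perm_compose -vb.
by rewrite -tpermJ conjgE mulKVg.
Qed.

Lemma cone_dim_weight_cone v w L : label_chain v w L ->
  cone_dim (@weight_cone R n v w) = \dim <<edge_vectors v L>>.
Proof.
move=> /label_group_up_reflections LE.
have key U : (@weight_cone R n v w `<=` [set` U])%classic <-> (<<edge_vectors v L>> <= U)%VS.
  rewrite weight_cone_subset -edge_vectorsP; split=> sub t x tin.
    apply: (edge_vectors_group sub).
    by have /(congr1 val) /= <- := LE; exact: mem_label_group.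
  have subL t' x' : t' \in [set z in L]%SET -> stdvec R (v x') - stdvec R (v (t' x')) \in U.
    by rewrite inE; exact: sub.
  apply: (edge_vectors_group subL).
  by have /(congr1 val) /= -> := LE; exact: mem_gen.
rewrite /cone_dim; case: ex_minnP => k /asboolP[U /key sub <-] kmin.
apply/eqP; rewrite eqn_leq; apply/andP; split; last exact: dimvS.
apply: kmin; apply/asboolP.
by exists <<edge_vectors v L>>%VS => //; apply/key.
Qed.

Definition chain_labels C : seq 'S_n :=
  if C is u :: C' then pairmap (fun x y => y * x^-1)%g u C' else [::].

Lemma chain_labelsP v w C : saturated_chain v w C ->
  label_chain v w (chain_labels C).
Proof.
case: C => // u C /= /and3P[/eqP <-].
elim: C u => [|z C IH] u /=; first by move=> _ /eqP ->; exact: label_chain_nil.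
move=> /andP[/and3P[uz /connectP[p pz zE] /eqP lz] pC lC].
(* Two or more Bruhat steps raise the length by at least two, so a cover is a single reflection. *)
have st : bruhat_step u z.
  case: p pz zE => [_ zE|y [|y' p] /=]; first by rewrite zE eqxx in uz.
    by rewrite andbT => st ->.
  move=> /andP[/bruhat_stepP[lt _] /andP[/bruhat_stepP[lt' _] pz]] zE.
  have : bruhat_le y' z by apply/connectP; exists p.
  by move/bruhat_le_inv; move: lz; rewrite !coxeter_lengthE; lia.
have [a [b tE]] : exists a b, (z * u^-1)%g = tperm a b.
  by have /bruhat_stepP[_ [a [b ->]]] := st; exists a, b; rewrite mulgK.
apply: label_chain_cons; first by exists a, b.
  by rewrite mulgKV -!coxeter_lengthE.
by rewrite mulgKV; exact: IH.
Qed.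

Lemma chain_graphE C a b : chain_graph C a b = (tperm a b \in chain_labels C).
Proof.
case: C => [|u C] /=; first by apply/negbTE/existsP; case; case.
rewrite /chain_graph; apply/existsP/(nthP 1%g) => [[i /eqP e]|[k kC]].
  exists i; first by rewrite size_pairmap.
  by rewrite (nth_pairmap 1%g) //= -[nth _ C i]/(nth 1%g (u :: C) i.+1) e mulgK.
move: kC; rewrite size_pairmap => kC; rewrite (nth_pairmap 1%g) // => e.
by exists (Ordinal kC); rewrite /= /perm_compose -e mulgKV.
Qed.

Lemma edge_vectors_rcons v L a b :
  <<edge_vectors v (rcons L (tperm a b))>>%VS =
  (<<edge_vectors v L>> + <[stdvec R (v a) - stdvec R (v b)]>)%VS.
Proof.
apply/eqP; rewrite eqEsubv; apply/andP; split.
  apply/edge_vectorsP => t x; rewrite mem_rcons inE => /orP[/eqP ->|tL].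
    have mem : stdvec R (v a) - stdvec R (v b) \in
      (<<edge_vectors v L>> + <[stdvec R (v a) - stdvec R (v b)]>)%VS.
      by rewrite (subvP (addvSr _ _)) // memv_line.
    case: tpermP => [->|->|_ _] //; last by rewrite subrr mem0v.
    by rewrite -opprB rpredN.
  by rewrite (subvP (addvSl _ _)) //; move: t x tL; apply/edge_vectorsP.
rewrite subv_add; apply/andP; split.
  apply/edge_vectorsP => t x tL.
  move: (subvv <<edge_vectors v (rcons L (tperm a b))>>) => /edge_vectorsP; apply.
  by rewrite mem_rcons inE tL orbT.
rewrite -memvE -[in X in _ - stdvec R (v X)](tpermL a b).
move: (subvv <<edge_vectors v (rcons L (tperm a b))>>) => /edge_vectorsP; apply.
by rewrite mem_rcons mem_head.
Qed.

Lemma mem_edge_vectors v C a b : (forall t, t \in chain_labels C -> exists a b, t = tperm a b) ->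
  (stdvec R (v a) - stdvec R (v b) \in <<edge_vectors v (chain_labels C)>>%VS)
  = connect (chain_graph C) a b.
Proof.
move=> tC; apply/idP/idP; last first.
  move=> /connectP[p]; elim: p a => [|c p IH] a /=.
    by move=> _ ->; rewrite subrr mem0v.
  move=> /andP[ac cp] bE; rewrite -(subrKA (stdvec R (v c))) rpredD ?(IH _ cp) //.
  rewrite chain_graphE in ac; rewrite -[in X in _ - stdvec R (v X)](tpermL a c).
  by move: (subvv <<edge_vectors v (chain_labels C)>>) => /edge_vectorsP; apply.
(* The indicator of the component of [a], transported by [v], is a linear form that kills every edge
   vector; its value on the given vector decides whether [b] lies in that component. *)
pose F : 'cV[R]_n := \col_y (connect (chain_graph C) a ((v^-1)%g y))%:R.
pose f := linfun (mulmxr F : 'rV[R]_n -> 'M[R]_1).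
have fE x y : f (stdvec R (v x) - stdvec R (v y)) =
  (connect (chain_graph C) a x)%:R%:M - (connect (chain_graph C) a y)%:R%:M.
  rewrite lfunE /= mulmxBl /stdvec -!rowE.
  by congr (_ - _); apply/matrixP => k l; rewrite !mxE permK !ord1 mulr1n.
have ker : (<<edge_vectors v (chain_labels C)>> <= lker f)%VS.
  apply/edge_vectorsP => t x tL; rewrite memv_ker fE subr_eq0.
  have [c [d tE]] := tC _ tL.
  have cd : chain_graph C c d by rewrite chain_graphE -tE.
  have dc : chain_graph C d c by rewrite chain_graphE tpermC -tE.
  rewrite tE; apply/eqP; congr (_%:R%:M); congr nat_of_bool.
  case: tpermP => [->|->|//]; apply/idP/idP => h;
    by apply: connect_trans h (connect1 _).
move=> /(subvP ker); rewrite memv_ker fE connect0 subr_eq0.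
case: connect => // /eqP/matrixP/(_ 0 0); rewrite !mxE /= => /eqP.
by rewrite oner_eq0.
Qed.

Lemma chain_labels_tperm v w L t : label_chain v w L -> t \in L ->
  exists a b, t = tperm a b.
Proof.
elim=> // x u y M tE _ _ IH; rewrite inE => /orP[/eqP -> //|]; exact: IH.
Qed.

Lemma cone_dim_cover v w' w C a b : saturated_chain v w' C ->
  bruhat_cover w' w -> w = perm_compose w' (tperm a b) ->
  cone_dim (@weight_cone R n v w) =
  (cone_dim (@weight_cone R n v w') + ~~ connect (chain_graph C) a b)%N.
Proof.
move=> /chain_labelsP CC /and3P[_ _ /eqP lw] wE.
have CC' : label_chain v w (rcons (chain_labels C) (tperm a b)).
  rewrite wE; apply: label_chain_rcons => //; first by exists a, b.
  by rewrite -!coxeter_lengthE -lw wE.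
rewrite (cone_dim_weight_cone CC) (cone_dim_weight_cone CC') edge_vectors_rcons.
rewrite -(@mem_edge_vectors v C a b); last by move=> t; exact: chain_labels_tperm CC.
set U := <<edge_vectors v (chain_labels C)>>%VS; set u := _ - _.
case: (boolP (u \in U)) => uU.
  have /addv_idPl -> : (<[u]> <= U)%VS by rewrite -memvE.
  by rewrite addn0.
have u0 : u != 0 by apply: contraNneq uU => ->; exact: mem0v.
rewrite dimv_disjoint_sum ?dim_vline ?u0 //.
apply/eqP; rewrite -subv0; apply/subvP => x; rewrite memv_cap => /andP[xU /vlineP[k xE]].
rewrite memv0 xE; move: xU; rewrite xE; have [->|k0] := eqVneq k 0; first by rewrite scale0r.
by rewrite rpredZeq (negbTE k0) (negbTE uU).
Qed.

End ConeDimension.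

(** * Gaussian elimination along a strict order *)

Section Elimination.
Variables (K : fieldType) (n : nat).
Implicit Types (P : rel 'I_n) (M X g : 'M[K]_n).
Local Open Scope ring_scope.

Definition unipotent_on P M : Prop := forall i j, ~~ P i j -> M i j = (i == j)%:R.

(** The matrix is triangular for the ranking [r], which need not follow the order of the indices. A
    left null vector vanishes at the indices of largest rank first. *)
Lemma unitmx_of_rank (r : 'I_n -> nat) M :
  (forall i, M i i != 0) -> (forall i j, i != j -> M i j != 0 -> (r j < r i)%N) ->
  M \in unitmx.
Proof.
move=> dM rM; rewrite -row_free_unit -kermx_eq0; apply/eqP/row_matrixP => k.
rewrite row0; set u : 'rV[K]_n := row k (kermx M).
have uM : u *m M = 0 by rewrite -row_mul mulmx_ker row0.
move: u uM => u uM.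
pose b := (\sum_i r i)%N.
have rb i : (r i <= b)%N by rewrite /b (bigD1 i) //= leq_addr.
suff u0 m j : (b - r j < m)%N -> u 0 j = 0.
  by apply/rowP => j; rewrite [RHS]mxE; exact: (u0 (b - r j).+1).
elim: m j => // m IH j jm.
have /rowP/(_ j) := uM; rewrite !mxE (bigD1 j) //= big1 ?addr0.
  by move/eqP; rewrite mulf_eq0 (negbTE (dM j)) orbF => /eqP.
move=> i ij; have [->|nz] := eqVneq (M i j) 0; first by rewrite mulr0.
by rewrite IH ?mul0r //; have := rM _ _ ij nz; have := rb i; lia.
Qed.

(* The principal submatrix on [A], completed by the identity so as to keep the size [n]. *)
Definition restrict_mx (A : pred 'I_n) M : 'M[K]_n :=
  \matrix_(k, j) if A k && A j then M k j else (k == j)%:R.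

(** The row [u] supported on [P i] for which [(e_i + u) g] vanishes on [P i]: a square linear
    system, whose matrix is the principal submatrix of [g] on [P i]. *)
Definition elim_row P g i : 'rV[K]_n :=
  (\row_j (if P i j then - g i j else 0)) *m invmx (restrict_mx (P i) g).

(* The matrix [X] unipotent on [P] for which [X g] vanishes on [P]. *)
Definition elim_mx P g : 'M[K]_n := \matrix_(i, j) ((i == j)%:R + elim_row P g i 0 j).

Definition elim_ok P g : Prop := forall i, restrict_mx (P i) g \in unitmx.

Lemma elim_rowE P g i (u : 'rV[K]_n) : restrict_mx (P i) g \in unitmx ->
  (forall j, ~~ P i j -> u 0 j = 0) ->
  (forall j, P i j -> \sum_k u 0 k * g k j = - g i j) -> u = elim_row P g i.
Proof.
move=> un supp eqs; rewrite /elim_row; apply: (canRL (mulmxK un)).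
apply/rowP => j; rewrite !mxE; case: ifP => Pj.
  rewrite -eqs //; apply: eq_bigr => k _; rewrite !mxE Pj andbT.
  by case: ifP => // /negbT/supp ->; rewrite !mul0r.
rewrite big1 // => k _; rewrite mxE Pj andbF.
by case: eqP => [->|]; rewrite ?mulr0 // supp ?mul0r ?Pj.
Qed.

Lemma elim_row_supp P g i j : restrict_mx (P i) g \in unitmx ->
  ~~ P i j -> elim_row P g i 0 j = 0.
Proof.
move=> un Pj; have := mulmxKV un (\row_j (if P i j then - g i j else 0)).
rewrite -/(elim_row P g i); move: (elim_row P g i) => u /rowP/(_ j).
rewrite !mxE (negbTE Pj) (bigD1 j) //= mxE (negbTE Pj) andbF eqxx mulr1 big1 ?addr0 // => k kj.
by rewrite mxE (negbTE Pj) andbF (negbTE kj) mulr0.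
Qed.

Lemma elim_mx_unipotent P g : elim_ok P g -> unipotent_on P (elim_mx P g).
Proof. by move=> ok i j Pij; rewrite mxE elim_row_supp ?addr0. Qed.

Lemma elim_mx_zero P g i j : elim_ok P g -> P i j -> (elim_mx P g *m g) i j = 0.
Proof.
move=> ok Pij; rewrite mxE.
under eq_bigr => k _ do rewrite mxE mulrDl.
rewrite big_split /= (bigD1 i) //= eqxx mul1r big1 => [|k ki]; last first.
  by rewrite eq_sym (negbTE ki) mul0r.
have := mulmxKV (ok i) (\row_j (if P i j then - g i j else 0)).
rewrite -/(elim_row P g i).
have := @elim_row_supp P g i ^~ (ok i); move: (elim_row P g i) => u supp /rowP/(_ j).
rewrite !mxE Pij => e.
rewrite addr0 -[X in _ + X]opprK -[X in X + _]opprK -opprD -e.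
apply/eqP; rewrite oppr_eq0 subr_eq0; apply/eqP/eq_bigr => k _; rewrite mxE Pij andbT.
by case: ifP => // /negbT Pk; rewrite supp ?mul0r.
Qed.

Lemma elim_mxE P g X : irreflexive P -> elim_ok P g -> unipotent_on P X ->
  (forall i j, P i j -> (X *m g) i j = 0) -> X = elim_mx P g.
Proof.
move=> irr ok uX X0; apply/matrixP => i j; rewrite mxE.
rewrite -(@elim_rowE P g i (row i X - delta_mx 0 i)) //.
- by rewrite !mxE eqxx /= [j == i]eq_sym [RHS]addrC; rewrite subrK.
- by move=> k Pk; rewrite !mxE uX // eqxx /= [k == i]eq_sym subrr.
move=> k Pk; have := X0 _ _ Pk; rewrite mxE => e.
under eq_bigr => l _ do rewrite !mxE mulrBl.
rewrite sumrB e sub0r (bigD1 i) //= eqxx mul1r big1 ?addr0 // => l li.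
by rewrite (negbTE li) mul0r.
Qed.

Section StrictOrder.
Variables (P : rel 'I_n) (r : 'I_n -> nat).
Hypothesis Prank : forall i j, P i j -> (r j < r i)%N.

Lemma rank_irreflexive : irreflexive P.
Proof. by move=> i; apply/negP => /Prank; rewrite ltnn. Qed.

Lemma unipotent_diag M i : unipotent_on P M -> M i i = 1.
Proof. by move=> uM; rewrite uM ?rank_irreflexive // eqxx. Qed.

Lemma unipotent_unit M : unipotent_on P M -> M \in unitmx.
Proof.
move=> uM; apply: (@unitmx_of_rank r) => [i|i j ij].
  by rewrite unipotent_diag ?oner_eq0.
by apply: contraNT => nr; rewrite uM ?(negbTE ij) //; apply: contra nr => /Prank.
Qed.

Lemma unipotent_mul M M' : transitive P ->
  unipotent_on P M -> unipotent_on P M' -> unipotent_on P (M *m M').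
Proof.
move=> tr uM uM' i j Pij; rewrite mxE (bigD1 i) //= unipotent_diag // mul1r.
rewrite uM' // big1 ?addr0 // => k ki.
have [Pik|nPik] := boolP (P i k); last by rewrite uM // eq_sym (negbTE ki) mul0r.
have [Pkj|nPkj] := boolP (P k j); first by rewrite (tr _ _ _ Pik Pkj) in Pij.
rewrite (uM' _ _ nPkj); have [e|] := eqVneq k j; last by rewrite mulr0.
by rewrite -e Pik in Pij.
Qed.

Lemma elim_ok_unipotent (P' : rel 'I_n) M : unipotent_on P M -> elim_ok P' M.
Proof.
move=> uM i; apply: unipotent_unit => k j Pkj; rewrite mxE.
by case: ifP => // _; exact: uM.
Qed.

(** The elimination matrix of [M] is its inverse: the product is unipotent on [P] by transitivity
    and zero on [P] by elimination, hence the identity. *)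
Lemma unipotent_inv M : transitive P -> unipotent_on P M -> unipotent_on P (invmx M).
Proof.
move=> tr uM; have ok := elim_ok_unipotent P uM.
have uX := elim_mx_unipotent ok.
have XM : elim_mx P M *m M = 1%:M.
  apply/matrixP => i j; have [Pij|nPij] := boolP (P i j); last first.
    by rewrite (unipotent_mul tr uX uM nPij) mxE.
  rewrite elim_mx_zero // mxE; case: eqP => // ij.
  by rewrite ij rank_irreflexive in Pij.
by rewrite -[invmx M]mul1mx -XM mulmxK // unipotent_unit.
Qed.

End StrictOrder.

Lemma sub_unipotent P P' M : (forall i j, P i j -> P' i j) ->
  unipotent_on P M -> unipotent_on P' M.
Proof. by move=> sub uM i j nP; apply: uM; apply: contra nP; exact: sub. Qed.

(* Restriction is multiplicative when no entry of [B] leads back into [A]. *)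
Lemma restrict_mx_mul (A : pred 'I_n) M (B : 'M[K]_n) :
  (forall k j, ~~ A k -> A j -> B k j = 0) ->
  restrict_mx A (M *m B) = restrict_mx A M *m restrict_mx A B.
Proof.
move=> B0; apply/matrixP => k j; rewrite !mxE.
case Ak: (A k); case Aj: (A j) => /=.
- apply: eq_bigr => l _; rewrite !mxE Ak Aj andbT /=.
  case Al: (A l) => //=; rewrite (B0 l j) ?Al // mulr0.
  by case: eqP => [e|]; rewrite ?mulr0 ?mul0r //; move: Al; rewrite -e Ak.
- rewrite (bigD1 j) //= !mxE Aj andbF eqxx mulr1 big1 ?addr0 // => l lj.
  by rewrite [X in _ * X]mxE Aj andbF (negbTE lj) mulr0.
- rewrite (bigD1 k) //= !mxE Ak /= eqxx mul1r big1 ?addr0 // => l lk.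
  by rewrite mxE Ak /= eq_sym (negbTE lk) mul0r.
- rewrite (bigD1 k) //= !mxE Ak /= eqxx mul1r big1 ?addr0 // => l lk.
  by rewrite mxE Ak /= eq_sym (negbTE lk) mul0r.
Qed.

End Elimination.

(** * Polynomial and rational functions *)

Section RingClasses.
Variable K : numFieldType.
Local Open Scope ring_scope.

(** Polynomial and rational functions are both classes of this kind, so that closure under matrix
    products, determinants and adjugates is proved once. *)
Definition ring_class T (F : (T -> K) -> Prop) : Prop :=
  [/\ forall c, F (fun=> c),
      forall f g, F f -> F g -> F (fun x => f x + g x) &
      forall f g, F f -> F g -> F (fun x => f x * g x)].

Section Closure.
Variables (T : Type) (F : (T -> K) -> Prop).
Hypothesis FC : ring_class F.

Lemma class_const c : F (fun=> c). Proof. by case: FC. Qed.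
Lemma class_add f g : F f -> F g -> F (fun x => f x + g x). Proof. by case: FC => _ + _; apply. Qed.
Lemma class_mul f g : F f -> F g -> F (fun x => f x * g x). Proof. by case: FC => _ _; apply. Qed.

Lemma class_sum (I : Type) (r : seq I) (P : pred I) (f : I -> T -> K) :
  (forall i, F (f i)) -> F (fun x => \sum_(i <- r | P i) f i x).
Proof.
move=> Ff; elim: r => [|i r IH].
  by under eq_fun do rewrite big_nil; exact: class_const.
under eq_fun do rewrite big_cons; case: (P i) => //; exact: class_add.
Qed.

Lemma class_prod (I : Type) (r : seq I) (P : pred I) (f : I -> T -> K) :
  (forall i, F (f i)) -> F (fun x => \prod_(i <- r | P i) f i x).
Proof.
move=> Ff; elim: r => [|i r IH].
  by under eq_fun do rewrite big_nil; exact: class_const.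
under eq_fun do rewrite big_cons; case: (P i) => //; exact: class_mul.
Qed.

Lemma class_exp f k : F f -> F (fun x => f x ^+ k).
Proof.
move=> Ff; elim: k => [|k IH]; first exact: class_const.
by under eq_fun do rewrite exprS; exact: class_mul.
Qed.

Definition mx_class m n (M : T -> 'M[K]_(m, n)) : Prop := forall i j, F (fun x => M x i j).

Lemma mx_class_const m n (A : 'M[K]_(m, n)) : mx_class (fun=> A).
Proof. by move=> i j; exact: class_const. Qed.

Lemma mx_class_mul m n p (M : T -> 'M[K]_(m, n)) (M' : T -> 'M[K]_(n, p)) :
  mx_class M -> mx_class M' -> mx_class (fun x => M x *m M' x).
Proof.
move=> cM cM' i j; under eq_fun do rewrite mxE.
by apply: class_sum => k; exact: class_mul.
Qed.

Lemma mx_class_det n (M : T -> 'M[K]_n) : mx_class M -> F (fun x => \det (M x)).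
Proof.
move=> cM; rewrite /determinant; apply: class_sum => s.
by apply: class_mul; [exact: class_const | exact: class_prod].
Qed.

Lemma mx_class_adj n (M : T -> 'M[K]_n) : mx_class M -> mx_class (fun x => \adj (M x)).
Proof.
move=> cM i j; under eq_fun do rewrite mxE /cofactor.
apply: class_mul; first exact: class_const.
by apply: mx_class_det => k l; under eq_fun do rewrite !mxE.
Qed.

Lemma mx_class_restrict n (A : pred 'I_n) (M : T -> 'M[K]_n) :
  mx_class M -> mx_class (fun x => restrict_mx A (M x)).
Proof.
move=> cM i j; under eq_fun do rewrite mxE.
by case: (A i && A j) => //; exact: class_const.
Qed.

End Closure.

Inductive fun_ring T (S : (T -> K) -> Prop) : (T -> K) -> Prop :=
| fun_ring_gen f : S f -> fun_ring S f
| fun_ring_const c : fun_ring S (fun=> c)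
| fun_ring_add f g : fun_ring S f -> fun_ring S g -> fun_ring S (fun x => f x + g x)
| fun_ring_mul f g : fun_ring S f -> fun_ring S g -> fun_ring S (fun x => f x * g x).

Lemma fun_ringC T (S : (T -> K) -> Prop) : ring_class (fun_ring S).
Proof.
by split; [exact: fun_ring_const | exact: fun_ring_add | exact: fun_ring_mul].
Qed.

Lemma fun_ring_comp T T' (S : (T -> K) -> Prop) (F : (T' -> K) -> Prop) (h : T' -> T) f :
  ring_class F -> (forall s, S s -> F (s \o h)) -> fun_ring S f -> F (f \o h).
Proof.
move=> FC Sh; elim=> {f} [f /Sh //|c|f g _ Ff _ Fg|f g _ Ff _ Fg].
- exact: (class_const FC c).
- exact: (class_add FC Ff Fg).
- exact: (class_mul FC Ff Fg).
Qed.

Definition rational_on T (S : (T -> K) -> Prop) (D : T -> Prop) (f : T -> K) : Prop :=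
  exists p q, [/\ fun_ring S p, fun_ring S q &
    forall x, D x -> q x != 0 /\ f x = p x / q x].

Section Rational.
Variables (T : Type) (S : (T -> K) -> Prop) (D : T -> Prop).
Local Notation rat := (rational_on S D).

Lemma rational_ring f : fun_ring S f -> rat f.
Proof.
move=> Sf; exists f, (fun=> 1); split=> //; first exact: fun_ring_const.
by move=> x _; rewrite oner_eq0 divr1.
Qed.

Lemma rationalC : ring_class rat.
Proof.
split=> [c|f g [p [q [Sp Sq pq]]] [p' [q' [Sp' Sq' pq']]]
          |f g [p [q [Sp Sq pq]]] [p' [q' [Sp' Sq' pq']]]].
- exact/rational_ring/fun_ring_const.
- exists (fun x => p x * q' x + p' x * q x), (fun x => q x * q' x); split.
  + by apply: fun_ring_add; exact: fun_ring_mul.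
  + exact: fun_ring_mul.
  + move=> x Dx; have [q0 ->] := pq x Dx; have [q0' ->] := pq' x Dx.
    by rewrite mulf_neq0 // addf_div.
- exists (fun x => p x * p' x), (fun x => q x * q' x); split.
  + exact: fun_ring_mul.
  + exact: fun_ring_mul.
  + move=> x Dx; have [q0 ->] := pq x Dx; have [q0' ->] := pq' x Dx.
    by rewrite mulf_neq0 // mulf_div.
Qed.

Lemma rational_eq f g : (forall x, D x -> f x = g x) -> rat f -> rat g.
Proof.
move=> fg [p [q [Sp Sq pq]]]; exists p, q; split=> // x Dx.
by rewrite -fg //; exact: pq.
Qed.

Lemma rational_inv f : (forall x, D x -> f x != 0) -> rat f -> rat (fun x => (f x)^-1).
Proof.
move=> f0 [p [q [Sp Sq pq]]]; exists q, p; split=> // x Dx.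
have [q0 fE] := pq x Dx; rewrite fE invf_div; split=> //.
by apply: contraNneq (f0 x Dx) => p0; rewrite fE p0 mul0r.
Qed.

Lemma rational_invmx n (M : T -> 'M[K]_n) : (forall x, D x -> M x \in unitmx) ->
  mx_class rat M -> mx_class rat (fun x => invmx (M x)).
Proof.
move=> uM rM i j.
apply: (@rational_eq (fun x => (\det (M x))^-1 * \adj (M x) i j)).
  by move=> x Dx; rewrite /invmx uM // [RHS]mxE.
apply: (class_mul rationalC).
  apply: rational_inv; last exact: (mx_class_det rationalC rM).
  by move=> x /uM; rewrite unitmxE unitfE.
exact: (mx_class_adj rationalC rM).
Qed.

Lemma rational_elim_mx n (P : rel 'I_n) (g : T -> 'M[K]_n) :
  (forall x, D x -> elim_ok P (g x)) -> mx_class rat g ->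
  mx_class rat (fun x => elim_mx P (g x)).
Proof.
move=> ok rg i j; under eq_fun do rewrite mxE.
apply: (class_add rationalC); first exact: (class_const rationalC).
apply: (mx_class_mul rationalC).
  move=> a b; under eq_fun do rewrite mxE; case: (P i b); last exact: (class_const rationalC).
  have -> : (fun x => - g x i b) = (fun x => -1 * g x i b).
    by apply/funext => x; rewrite mulN1r.
  by apply: (class_mul rationalC) => //; exact: (class_const rationalC).
apply: rational_invmx; first by move=> x /ok.
exact: (mx_class_restrict rationalC _ rg).
Qed.

End Rational.

Lemma rational_comp T T' (S : (T -> K) -> Prop) (S' : (T' -> K) -> Prop) D (h : T' -> T) f :
  (forall s, S s -> fun_ring S' (s \o h)) -> rational_on S D f ->
  rational_on S' (fun x => D (h x)) (f \o h).
Proof.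
move=> Sh [p [q [Sp Sq pq]]]; exists (p \o h), (q \o h).
split; [exact: (fun_ring_comp (fun_ringC S') Sh Sp)|exact: (fun_ring_comp (fun_ringC S') Sh Sq)|].
by move=> x; exact: pq.
Qed.

Lemma poly_nat_roots (p : {poly K}) m : (size p <= m)%N ->
  (forall k, (k < m)%N -> p.[k%:R] = 0) -> p = 0.
Proof.
move=> sp rp; apply/eqP; apply: contraTT sp => p0; rewrite -ltnNge.
rewrite -{1}(size_iota 0 m) -(size_map (fun k => k%:R : K)); apply: max_poly_roots => //.
  by apply/allP => _ /mapP[k + ->]; rewrite mem_iota => /andP[_ km]; apply/rootP/rp.
by rewrite map_inj_uniq ?iota_uniq //; exact: (mulrIn (oner_neq0 K)).
Qed.

Lemma poly_eq0 (p : {poly K}) : (forall t, p.[t] = 0) -> p = 0.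
Proof. by move=> p0; apply: (@poly_nat_roots p (size p)). Qed.

(** * Polynomial functions on an affine space *)

Section Coordinates.
Variable I : finType.
Implicit Types (x y : I -> K) (f g : (I -> K) -> K).

Definition coordinate f : Prop := exists i, f = (fun x => x i).

Lemma fun_ring_line f x y : fun_ring coordinate f ->
  exists p : {poly K}, forall t, f (fun i => x i + t * (y i - x i)) = p.[t].
Proof.
elim=> {f} [f [i ->]|c|f g _ [p pE] _ [q qE]|f g _ [p pE] _ [q qE]].
- by exists ((x i)%:P + 'X * (y i - x i)%:P) => t; rewrite !hornerE.
- by exists c%:P => t; rewrite hornerC.
- by exists (p + q) => t; rewrite hornerD pE qE.
- by exists (p * q) => t; rewrite hornerM pE qE.
Qed.

(** Restrict both functions to the line through a point where [f] is nonzero and a point where [g]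
    is nonzero; polynomials in one variable form a domain. *)
Lemma fun_ring_domain f g : fun_ring coordinate f -> fun_ring coordinate g ->
  (forall x, f x * g x = 0) -> (forall x, f x = 0) \/ (forall x, g x = 0).
Proof.
move=> Sf Sg fg; apply: contrapT => /not_orP[/existsNP[x /eqP fx] /existsNP[y /eqP gy]].
have [p pE] := fun_ring_line x y Sf; have [q qE] := fun_ring_line x y Sg.
have /eqP : p * q = 0 by apply: poly_eq0 => t; rewrite hornerM -pE -qE fg.
rewrite mulf_eq0 => /orP[] /eqP z.
  move: fx; have := pE 0; rewrite z horner0; under eq_fun do rewrite mul0r addr0.
  by move=> ->; rewrite eqxx.
move: gy; have := qE 1; rewrite z horner0; under eq_fun do rewrite mul1r addrC subrK.
by move=> ->; rewrite eqxx.
Qed.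

Definition update x i t : I -> K := fun j => if j == i then t else x j.

(** The degree is bounded in each variable separately, as suits interpolation on a cubical grid. *)
Definition degree_le e f : Prop := forall i x, exists2 p : {poly K},
  (size p <= e.+1)%N & forall t, f (update x i t) = p.[t].

Lemma degree_leW e e' f : (e <= e')%N -> degree_le e f -> degree_le e' f.
Proof.
move=> ee' df i x; have [p sp pE] := df i x; exists p => //.
by rewrite (leq_trans sp).
Qed.

Lemma degree_le_const c : degree_le 0 (fun=> c).
Proof. by move=> i x; exists c%:P => [|t]; rewrite ?size_polyC ?leq_b1 ?hornerC. Qed.

Lemma degree_le_add e f g : degree_le e f -> degree_le e g ->
  degree_le e (fun x => f x + g x).
Proof.
move=> df dg i x; have [p sp pE] := df i x; have [q sq qE] := dg i x.
exists (p + q) => [|t]; last by rewrite hornerD pE qE.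
by rewrite (leq_trans (size_polyD _ _)) // geq_max sp.
Qed.

Lemma degree_le_mul e e' f g : degree_le e f -> degree_le e' g ->
  degree_le (e + e')%N (fun x => f x * g x).
Proof.
move=> df dg i x; have [p sp pE] := df i x; have [q sq qE] := dg i x.
exists (p * q) => [|t]; last by rewrite hornerM pE qE.
by apply: leq_trans (size_polyMleq p q) _; lia.
Qed.

Lemma degree_le_exp e f k : degree_le e f -> degree_le (k * e)%N (fun x => f x ^+ k).
Proof.
move=> df; elim: k => [|k IH]; first exact: degree_le_const.
under eq_fun do rewrite exprS; rewrite mulSn; exact: (degree_le_mul df IH).
Qed.

Lemma degree_le_sum e (J : Type) (r : seq J) (f : J -> (I -> K) -> K) :
  (forall j, degree_le e (f j)) -> degree_le e (fun x => \sum_(j <- r) f j x).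
Proof.
move=> df; elim: r => [|j r IH].
  under eq_fun do rewrite big_nil.
  exact: (degree_leW (leq0n e) (degree_le_const 0)).
under eq_fun do rewrite big_cons; exact: (degree_le_add (df j) IH).
Qed.

Lemma fun_ring_degree f : fun_ring coordinate f -> exists e, degree_le e f.
Proof.
elim=> {f} [f [i ->]|c|f g _ [e de] _ [e' de']|f g _ [e de] _ [e' de']].
- exists 1%N => j x; rewrite /update; case: eqP => _.
    by exists 'X => [|t]; rewrite ?size_polyX ?hornerX.
  by exists (x i)%:P => [|t]; rewrite ?hornerC // size_polyC; case: (_ != _).
- by exists 0%N; exact: degree_le_const.
- exists (maxn e e'); apply: degree_le_add.
    exact: (degree_leW (leq_maxl e e') de).
  exact: (degree_leW (leq_maxr e e') de').
- by exists (e + e')%N; exact: (degree_le_mul de de').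
Qed.

(** The coordinates leave the grid one at a time: in each of them [f] is a polynomial of degree at
    most [e] with the [e + 1] roots [0, ..., e]. The list [s] holds the coordinates already
    freed. *)
Lemma degree_le_grid e f : degree_le e f ->
  (forall a : {ffun I -> 'I_e.+1}, f (fun i => (a i)%:R) = 0) -> forall x, f x = 0.
Proof.
move=> df f0 x.
suff main (s : seq I) y : (forall i, i \notin s -> exists k : 'I_e.+1, y i = k%:R) -> f y = 0.
  by apply: (main (enum I)) => i; rewrite mem_enum.
elim: s y => [|i s IH] y ys.
  have /choice[k yk] : forall i, exists k : 'I_e.+1, y i = k%:R by move=> i; exact: ys.
  rewrite -(f0 (finfun k)); congr f; apply/funext => i; by rewrite ffunE yk.
have [p sp pE] := df i y.
have -> : y = update y i (y i) by apply/funext => j; rewrite /update; case: eqP => [->|].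
rewrite pE (@poly_nat_roots p e.+1) ?horner0 // => k ke.
rewrite -pE; apply: IH => j js; rewrite /update; case: eqP => [_|/eqP ji].
  by exists (Ordinal ke).
by apply: ys; rewrite inE negb_or ji.
Qed.

End Coordinates.
End RingClasses.

(** * Algebraic independence *)

Section Independence.
Variable K : numFieldType.
Local Open Scope ring_scope.

(** Nested pairs, with the exponent of the last function outermost: the inductions split off this
    function. *)
Fixpoint exponents (N k : nat) : finType :=
  if k is k'.+1 then ('I_N * exponents N k')%type else unit.

Lemma card_exponents N k : #|exponents N k| = (N ^ k)%N.
Proof.
by elim: k => [|k IH]; [rewrite card_unit | rewrite card_prod card_ord IH expnS].
Qed.

Fixpoint monomial T (f : nat -> T -> K) N k : exponents N k -> T -> K :=
  if k is k'.+1 then fun a x => f k' x ^+ a.1 * monomial f a.2 x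
  else fun _ _ => 1.

Definition independent_on T (D : T -> Prop) k (f : nat -> T -> K) : Prop :=
  forall N (c : exponents N k -> K),
    (forall x, D x -> \sum_a c a * monomial f a x = 0) -> forall a, c a = 0.

Lemma eq_monomial T T' (f : nat -> T -> K) (g : nat -> T' -> K) x y N k
  (a : exponents N k) : (forall i, (i < k)%N -> f i x = g i y) ->
  monomial f a x = monomial g a y.
Proof.
elim: k a => //= k IH [i a] fg /=; rewrite (fg k) // (IH a) // => j jk.
by apply: fg; exact: ltnW.
Qed.

Lemma independent_pullback T T' (D : T -> Prop) (D' : T' -> Prop) k f g :
  (forall x, D x -> exists2 y, D' y & forall i, (i < k)%N -> f i x = g i y) ->
  independent_on D k f -> independent_on D' k g.
Proof.
move=> DD' indf N c c0; apply: indf => x /DD'[y D'y fg].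
by rewrite -[RHS](c0 y D'y); apply: eq_bigr => a _; rewrite (eq_monomial a fg).
Qed.

Lemma monomial_class T (F : (T -> K) -> Prop) f N k (a : exponents N k) :
  ring_class F -> (forall i, (i < k)%N -> F (f i)) -> F (monomial f a).
Proof.
move=> FC; elim: k a => [a _|k IH [i a] Ff]; first exact: (class_const FC).
apply: (class_mul FC); first exact/(class_exp FC)/Ff.
by apply: IH => j jk; apply: Ff; exact: ltnW.
Qed.

Lemma sum_exponents N k (G : exponents N k.+1 -> K) :
  \sum_a G a = \sum_(i < N) \sum_(a : exponents N k) G (i, a).
Proof. by rewrite pair_bigA /=; apply: eq_bigr => -[]. Qed.

Section Irreducible.
Variables (T : Type) (F : (T -> K) -> Prop) (D0 D1 : T -> Prop) (k : nat) (f : nat -> T -> K).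
Hypothesis FC : ring_class F.
Hypothesis Ff : forall i, F (f i).
Hypothesis D01 : forall x, D0 x -> D1 x.
Hypothesis irr : forall g h, F g -> F h -> (forall x, D1 x -> g x * h x = 0) ->
  (forall x, D1 x -> g x = 0) \/ (forall x, D1 x -> h x = 0).

(* A relation of minimal order in [f k] restricts on [D0], where [f k] vanishes,
   to a relation between the preceding functions. *)
Lemma independent_step : independent_on D0 k f -> (forall x, D0 x -> f k x = 0) ->
  (exists2 x, D1 x & f k x != 0) -> independent_on D1 k.+1 f.
Proof.
move=> ind f0 [x1 Dx1 fx1] N c c0.
pose s (i : 'I_N) x := \sum_(a : exponents N k) c (i, a) * monomial f a x.
have sF i : F (s i).
  apply: (class_sum FC) => a; apply: (class_mul FC); first exact: (class_const FC).
  exact: monomial_class.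
have sum0 x : D1 x -> \sum_(i < N) f k x ^+ i * s i x = 0.
  move=> Dx; rewrite -[RHS](c0 x Dx) sum_exponents; apply: eq_bigr => i _.
  by rewrite mulr_sumr; apply: eq_bigr => a _; rewrite mulrCA.
suff main m : (forall i : 'I_N, (i < m)%N -> forall a, c (i, a) = 0).
  by move=> [i a]; apply: (main N).
elim: m => // m IH i; rewrite ltnS leq_eqVlt => /orP[/eqP im|]; last exact: IH.
(* The terms of order below [m] being zero, the relation reads [f k ^+ m * q = 0]. Irreducibility
   cancels the factors [f k] one at a time, and on [D0] the quotient [q] reduces to its term of
   index [m]. *)
pose q x := \sum_(j < N | (m <= j)%N) f k x ^+ (j - m) * s j x.
have qF : F q.
  apply: (class_sum FC) => j; apply: (class_mul FC) => //.
  exact/(class_exp FC).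
have s0 (j : 'I_N) x : (j < m)%N -> s j x = 0.
  by move=> jm; rewrite /s big1 // => a _; rewrite IH // mul0r.
have fq l : forall x, D1 x -> f k x ^+ (m - l) * q x = 0.
  elim: l => [|l IHl] x Dx.
    rewrite subn0 mulr_sumr -[RHS](sum0 x Dx) [RHS](bigID (fun j : 'I_N => (m <= j)%N)) /=.
    rewrite [X in _ = _ + X]big1 ?addr0 => [|j].
      by apply: eq_bigr => j mj; rewrite mulrA -exprD subnKC.
    by rewrite -ltnNge => /s0 ->; rewrite mulr0.
  have [lm|ml] := ltnP l m; last first.
    by have := IHl x Dx; have -> : (m - l = m - l.+1)%N by lia.
  have e : (m - l = (m - l.+1).+1)%N by lia.
  have gF : F (fun x => f k x ^+ (m - l.+1) * q x).
    by apply: (class_mul FC) => //; exact/(class_exp FC).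
  have /(irr (Ff k) gF)[z|z] : forall x, D1 x -> f k x * (f k x ^+ (m - l.+1) * q x) = 0.
  - by move=> y Dy; rewrite mulrA -exprS -e; exact: IHl.
  - by rewrite z ?eqxx in fx1.
  - exact: z.
apply: (ind N (fun a => c (i, a))) => x Dx; have := fq m _ (D01 Dx); rewrite subnn mul1r /q.
rewrite (bigD1 i) ?im //= subnn mul1r big1 ?addr0 // => j /andP[mj ji].
rewrite f0 // expr0n subn_eq0 leqNgt ltn_neqAle mj andbT.
by rewrite eq_sym -im val_eqE ji mul0r.
Qed.

End Irreducible.

(** For fixed values of the preceding functions a relation is a polynomial in the value [t] of the
    last one. It vanishes for all [t], so its coefficients are relations between the preceding
    functions. *)
Lemma independent_free T (D D' : T -> Prop) k (f : nat -> T -> K) :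
  (forall x t, D x -> exists y, [/\ D' y, f k y = t & forall i, (i < k)%N -> f i y = f i x]) ->
  independent_on D k f -> independent_on D' k.+1 f.
Proof.
move=> ext ind N c c0 [i a]; apply: (ind N (fun a => c (i, a))) => x Dx.
pose s (j : 'I_N) := \sum_(a : exponents N k) c (j, a) * monomial f a x.
rewrite -/(s i); pose p := \poly_(j < N) (if insub j is Some j' then s j' else 0).
have p0 : p = 0.
  apply: poly_eq0 => t; have [y [Dy fy fi]] := ext x t Dx.
  rewrite horner_poly -[RHS](c0 y Dy) sum_exponents; apply: eq_bigr => j _.
  rewrite valK mulr_suml; apply: eq_bigr => b _ /=.
  by rewrite (@eq_monomial _ _ f f y x _ _ b fi) fy -mulrA [X in _ * X = _]mulrC.
by have /polyP/(_ i) := p0; rewrite coef_poly ltn_ord valK coef0.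
Qed.

(* With a common denominator the monomials of degree < [N] in each [f i] become
   polynomials of degree at most [k N e] in each variable: these are determined by
   about [(k N e)^#|I|] values, whereas there are [N^k] monomials. *)
Lemma independent_bound (I : finType) (D : (I -> K) -> Prop) k (f : nat -> (I -> K) -> K) :
  (forall i, (i < k)%N -> rational_on (@coordinate K I) D (f i)) ->
  independent_on D k f -> (k <= #|I|)%N.
Proof.
move=> rat ind; rewrite leqNgt; apply/negP => Ik.
have /choice[p pP] : forall i, exists p : ((I -> K) -> K) * ((I -> K) -> K) * nat,
  (i < k)%N -> [/\ degree_le p.2 p.1.1, degree_le p.2 p.1.2 &
     forall x, D x -> p.1.2 x != 0 /\ f i x = p.1.1 x / p.1.2 x].
  move=> i; case: (ltnP i k) => [ik|]; last by exists (fun=> 0, fun=> 0, 0%N).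
  have [a [q [Sa Sq aq]]] := rat i ik.
  have [e de] := fun_ring_degree Sa; have [e' de'] := fun_ring_degree Sq.
  exists (a, q, maxn e e') => _; split=> //=.
    exact: (degree_leW (leq_maxl e e') de).
  exact: (degree_leW (leq_maxr e e') de').
pose e := (\max_(i < k) (p i).2)%N.
have le_e i : (i < k)%N -> ((p i).2 <= e)%N.
  by move=> ik; exact: (@leq_bigmax _ (fun i : 'I_k => (p i).2) (Ordinal ik)).
(* Large enough for [N ^ k] monomials to outnumber the grid: with [E = k N e] one has
   [E + 1 <= N (e k + 1)], hence [(E + 1) ^ #|I| <= N ^ #|I| (e k + 1) ^ #|I| < N ^ (#|I| + 1) <= N
   ^ k]. *)
pose N := ((e * k).+1 ^ #|I|).+1.
(* The monomial multiplied by the common denominator: the numerator to the power [a] and the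
   denominator to the power [N - a]. *)
pose fix hom (m : nat) : exponents N m -> (I -> K) -> K :=
  match m return exponents N m -> (I -> K) -> K with
  | 0 => fun _ _ => 1
  | m'.+1 => fun a x => (p m').1.1 x ^+ a.1 * (p m').1.2 x ^+ (N - a.1) * hom m' a.2 x
  end.
pose den x := \prod_(i < k) (p i).1.2 x ^+ N.
have den0 x : D x -> den x != 0.
  move=> Dx; apply/prodf_neq0 => i _; rewrite expf_neq0 //.
  by have [_ _ /(_ x Dx)[]] := pP i (ltn_ord i).
have homE m (a : exponents N m) x : (m <= k)%N -> D x ->
    hom m a x = monomial f a x * \prod_(i < m) (p i).1.2 x ^+ N.
  elim: m a => [a _ _|m IH [i a] mk Dx] /=; first by rewrite big_ord0 mulr1.
  have [_ _ /(_ x Dx)[q0 ->]] := pP m mk.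
  have qN : (p m).1.2 x ^+ N = (p m).1.2 x ^+ i * (p m).1.2 x ^+ (N - i).
    by rewrite -exprD subnKC // ltnW.
  rewrite IH ?(ltnW mk) // big_ord_recr /=; move: (\prod_(_ < m) _) => B.
  have qi : (p m).1.2 x ^+ i != 0 by rewrite expf_neq0.
  by rewrite qN expr_div_n; field.
have hom_deg m (a : exponents N m) : (m <= k)%N -> degree_le (m * (N * e))%N (hom m a).
  elim: m a => [a _|m IH [i a] mk] /=; first exact: degree_le_const.
  rewrite mulSn; apply: degree_le_mul; last by apply: IH; exact: ltnW.
  have [d1 d2 _] := pP m mk.
  have -> : (N * e = i * e + (N - i) * e)%N by rewrite -mulnDl subnKC // ltnW.
  by apply: degree_le_mul; apply: degree_le_exp; apply: degree_leW (le_e _ mk) _.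
pose E := (k * (N * e))%N.
(* With more rows than columns, [M] has a left null vector: a combination of the [hom k a] that
   vanishes on the grid, hence everywhere. *)
pose M := \matrix_(a < #|exponents N k|, g < #|{ffun I -> 'I_E.+1}|)
  hom k (enum_val a) (fun i => (enum_val g i)%:R).
have lt : (#|{ffun I -> 'I_E.+1}| < #|exponents N k|)%N.
  rewrite card_exponents card_ffun card_ord.
  have EN : (E.+1 <= N * (e * k).+1)%N by rewrite /E /N; nia.
  apply: leq_ltn_trans (_ : (N * (e * k).+1) ^ #|I| < _)%N.
    by move: #|I| EN => [|m] EN; rewrite ?expn0 ?leq_exp2r.
  rewrite expnMn; apply: leq_trans (_ : N ^ #|I|.+1 <= _)%N; last first.
    by rewrite leq_pexp2l.
  by rewrite expnSr ltn_pmul2l ?expn_gt0.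
have : kermx M != 0.
  rewrite kermx_eq0 /row_free; apply: contraL lt => /eqP rM.
  by rewrite -leqNgt -rM rank_leq_col.
move=> /rowV0Pn[c /sub_kermxP cM /rV0Pn[a0 c0]].
move/negP: c0; apply; apply/eqP.
rewrite -(enum_valK a0).
apply: (ind N (fun a => c 0 (enum_rank a))) => x Dx.
apply: (mulIf (den0 x Dx)); rewrite mul0r mulr_suml.
under eq_bigr => a _ do rewrite -mulrA -homE //.
apply: (@degree_le_grid K I E (fun x => \sum_(a : exponents N k) c 0 (enum_rank a) * hom k a x)).
  apply: degree_le_sum => a; rewrite -[E]add0n; apply: degree_le_mul.
    exact: degree_le_const.
  exact: hom_deg.
move=> g; have /rowP/(_ (enum_rank g)) := cM; rewrite !mxE => e0.
rewrite -[RHS]e0 (reindex (fun j : 'I_#|exponents N k| => enum_val j)) /=; last first.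
  by exists enum_rank => a _; rewrite ?enum_valK ?enum_rankK.
by apply: eq_bigr => a _; rewrite !mxE enum_valK enum_rankK.
Qed.

End Independence.

(** * Closures of Bruhat cells *)

Section MatrixSchubert.
Variables (K : numFieldType) (n : nat).
Local Open Scope ring_scope.
Implicit Types (u w : 'S_n) (a b g M : 'M[K]_n) (f : 'M[K]_n -> K).

Definition entry f : Prop := exists i j, f = (fun M => M i j).
Local Notation poly := (fun_ring entry).

Definition upper M : Prop := forall i j : 'I_n, (j < i)%N -> M i j = 0.

Definition wmx w : 'M[K]_n := (perm_mx w)^T.

Lemma wmxE w i j : wmx w i j = (w j == i)%:R.
Proof. by rewrite !mxE. Qed.

Lemma wmx_unit w : wmx w \in unitmx.
Proof. by rewrite unitmx_tr unitmx_perm. Qed.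

Definition cell_index : finType := (bool * ('I_n * 'I_n))%type.

Definition upper_of (c : bool) (x : cell_index -> K) : 'M[K]_n :=
  \matrix_(i, j) if (i <= j)%N then x (c, (i, j)) else 0.

Lemma upper_upper_of c x : upper (upper_of c x).
Proof. by move=> i j ji; rewrite mxE leqNgt ji. Qed.

Definition cell_point w x : 'M[K]_n := upper_of true x *m wmx w *m upper_of false x.

Lemma cell_pointP w a b : upper a -> upper b -> exists x, cell_point w x = a *m wmx w *m b.
Proof.
move=> ua ub; exists (fun p => if p.1 then a p.2.1 p.2.2 else b p.2.1 p.2.2).
have E (c : bool) d : upper d -> (if c then a = d else b = d) ->
    upper_of c (fun p => if p.1 then a p.2.1 p.2.2 else b p.2.1 p.2.2) = d.
  move=> ud cd; apply/matrixP => i j; rewrite mxE /=; case: leqP => [_|/ud -> //].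
  by case: c cd => ->.
by rewrite /cell_point (E true a) // (E false b).
Qed.

Lemma upper_mul a b : upper a -> upper b -> upper (a *m b).
Proof.
move=> ua ub i j ji; rewrite mxE big1 // => k _.
have [ik|ki] := leqP i k; last by rewrite ua ?mul0r.
by rewrite (ub k j) ?mulr0 // (leq_trans ji).
Qed.

Lemma upper1 : upper 1%:M.
Proof. by move=> i j ji; rewrite mxE -val_eqE /= gtn_eqF. Qed.

(* [cell_point w] is the parametrization of B w B, extended to singular triangular
   factors: this makes its domain an affine space and does not change the closure. *)
Definition cell_closure w g : Prop :=
  forall f, poly f -> (forall x, f (cell_point w x) = 0) -> f g = 0.

Lemma mx_class_entry : mx_class poly (fun M => M).
Proof. by move=> i j; apply: fun_ring_gen; exists i, j. Qed.

Lemma poly_entry_comp T (F : (T -> K) -> Prop) (h : T -> 'M[K]_n) f :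
  ring_class F -> mx_class F h -> poly f -> F (f \o h).
Proof.
move=> FC Fh; apply: fun_ring_comp => // _ [i [j ->]]; exact: Fh.
Qed.

Lemma poly_mul2 a b f : poly f -> poly (fun g => f (a *m g *m b)).
Proof.
move=> pf; apply: (@poly_entry_comp _ _ (fun g => a *m g *m b) f (fun_ringC _)) => //.
apply: (mx_class_mul (fun_ringC _)); last exact: (mx_class_const (fun_ringC _)).
apply: (mx_class_mul (fun_ringC _)); last exact: mx_class_entry.
exact: (mx_class_const (fun_ringC _)).
Qed.

Lemma cell_closure_mul w a b g : upper a -> upper b ->
  cell_closure w g -> cell_closure w (a *m g *m b).
Proof.
move=> ua ub cg f pf f0; apply: (cg _ (poly_mul2 a b pf)) => x.
have [y yE] : exists y, cell_point w y =
    (a *m upper_of true x) *m wmx w *m (upper_of false x *m b).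
  by apply: cell_pointP; apply: upper_mul => //; exact: upper_upper_of.
have <- : cell_point w y = a *m cell_point w x *m b by rewrite yE /cell_point !mulmxA.
exact: f0.
Qed.

Lemma cell_closure_point w x : cell_closure w (cell_point w x).
Proof. by move=> f _; apply. Qed.

Lemma cell_closure_wmx w : cell_closure w (wmx w).
Proof.
have [x e] := @cell_pointP w 1%:M 1%:M upper1 upper1.
by have := @cell_closure_point w x; rewrite e mul1mx mulmx1.
Qed.

Lemma mx_class_cell_point w : mx_class (fun_ring (@coordinate K cell_index)) (cell_point w).
Proof.
have up c : mx_class (fun_ring (@coordinate K cell_index)) (upper_of c).
  move=> i j; under eq_fun do rewrite mxE; case: leqP => _; last exact: fun_ring_const.
  by apply: fun_ring_gen; exists (c, (i, j)).
apply: (mx_class_mul (fun_ringC _)) => //; apply: (mx_class_mul (fun_ringC _)) => //.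
exact: (mx_class_const (fun_ringC _)).
Qed.

(** Irreducibility of the closure, read off on the affine space of parameters. *)
Lemma cell_closure_domain w f f' : poly f -> poly f' ->
  (forall x, f (cell_point w x) * f' (cell_point w x) = 0) ->
  (forall g, cell_closure w g -> f g = 0) \/ (forall g, cell_closure w g -> f' g = 0).
Proof.
move=> pf pf' ff'.
have pc h : poly h -> fun_ring (@coordinate K cell_index) (h \o cell_point w).
  by apply: poly_entry_comp; [exact: fun_ringC | exact: mx_class_cell_point].
case: (fun_ring_domain (pc f pf) (pc f' pf') ff') => z; [left|right] => g cg; exact: cg.
Qed.

(** Density of the locus where [d] is nonzero; [g0] witnesses that this locus is not empty. *)
Lemma cell_closure_generic w f d g0 : poly f -> poly d ->
  (forall x, d (cell_point w x) != 0 -> f (cell_point w x) = 0) ->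
  cell_closure w g0 -> d g0 != 0 -> forall g, cell_closure w g -> f g = 0.
Proof.
move=> pf pd fd cg0 dg0; have [x|//|z] := cell_closure_domain pf pd (w := w).
  by have [->|/fd ->] := eqVneq (d (cell_point w x)) 0; rewrite ?mulr0 ?mul0r.
by rewrite z ?eqxx in dg0.
Qed.

Lemma cell_closure_sub w u g : cell_closure w (wmx u) -> cell_closure u g -> cell_closure w g.
Proof.
move=> cu cg f pf f0; apply: cg => // x.
by apply: (cell_closure_mul (upper_upper_of true x) (upper_upper_of false x) cu).
Qed.

Lemma upper_delta (i j : 'I_n) c : (i <= j)%N -> upper (c *: delta_mx i j).
Proof.
move=> ij k l lk; rewrite !mxE; have [ki|] := eqVneq k i; last by rewrite mulr0.
by have [lj|] := eqVneq l j; rewrite ?mulr0 //; move: lk; rewrite ki lj ltnNge ij.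
Qed.

Lemma upper_add a b : upper a -> upper b -> upper (a + b).
Proof. by move=> ua ub i j ji; rewrite mxE ua // ub // addr0. Qed.

Lemma wmx_delta w (i j : 'I_n) : wmx w *m delta_mx i j = delta_mx (w i) j.
Proof.
apply/matrixP => k l; rewrite mxE (bigD1 i) //= big1 ?addr0 => [|m mi]; last first.
  by rewrite !mxE (negbTE mi) mulr0.
by rewrite wmxE !mxE eqxx /= -natrM mulnb eq_sym.
Qed.

Lemma delta_wmx w (i j : 'I_n) : delta_mx i (w j) *m wmx w = delta_mx i j.
Proof.
apply/matrixP => k l; rewrite mxE (bigD1 (w j)) //= big1 ?addr0 => [|m mi]; last first.
  by rewrite !mxE (negbTE mi) andbF mul0r.
by rewrite wmxE !mxE eqxx andbT -natrM mulnb (inj_eq perm_inj).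
Qed.

Lemma wmx_tperm w (i j : 'I_n) : i != j -> wmx (tperm i j * w)%g =
  wmx w - delta_mx (w i) i - delta_mx (w j) j + delta_mx (w i) j + delta_mx (w j) i.
Proof.
move=> ij; apply/matrixP => k l; rewrite !mxE permM ![k == _]eq_sym.
case: tpermP => [->|->|/eqP li /eqP lj]; rewrite ?eqxx.
- by rewrite [i == j](negbTE ij) !andbT !andbF; ring.
- by rewrite [j == i]eq_sym (negbTE ij) !andbT !andbF; ring.
- by rewrite (negbTE li) (negbTE lj) !andbF; ring.
Qed.

Lemma poly_line f M d : poly f -> exists p : {poly K}, forall t, f (M + t *: d) = p.[t].
Proof.
elim=> {f} [f [i [j ->]]|c|f g _ [p pE] _ [q qE]|f g _ [p pE] _ [q qE]].
- by exists ((M i j)%:P + 'X * (d i j)%:P) => t; rewrite !mxE !hornerE.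
- by exists c%:P => t; rewrite hornerC.
- by exists (p + q) => t; rewrite hornerD pE qE.
- by exists (p * q) => t; rewrite hornerM pE qE.
Qed.

(* [u] is the limit at [t = 0] of [u + t E_(w i, i)], which lies in B w B for [t <> 0]. *)
Lemma cell_closure_step u w : bruhat_step u w -> cell_closure w (wmx u).
Proof.
rewrite -{1}(mulgKV u w) => /bruhat_step_tperm[i [j [tE ij uij]]].
have uE : u = (tperm i j * w)%g by rewrite -(mulgKV u w) tE mulgA tperm2 mul1g.
have [wi wj] : w i = u j /\ w j = u i by rewrite uE !permM tpermL tpermR.
have nij : i != j by rewrite -val_eqE /= ltn_eqF.
have nji : j != i by rewrite eq_sym.
move=> f pf f0.
have [p pE] := poly_line (wmx u) (delta_mx (w i) i) pf.
suff p0 : p = 0 by have := pE 0; rewrite p0 horner0 scale0r addr0.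
(* The factor ['X] disposes of the value [t = 0]. *)
have /eqP : p * 'X = 0.
  apply: poly_eq0 => t; rewrite hornerM hornerX -pE.
  have [->|t0] := eqVneq t 0; first by rewrite mulr0.
  (* In the rows [w j < w i] and the columns [i < j], the factorization is [[1, 0], [t, 1]] =
     [[1, 1/t], [0, 1]] [[0, 1], [1, 0]] [[t, 1], [0, -1/t]]. *)
  pose u1 : 'M[K]_n := 1%:M + t^-1 *: delta_mx (w j) (w i).
  pose u2 : 'M[K]_n := 1%:M + (t - 1) *: delta_mx i i + (- t^-1 - 1) *: delta_mx j j
    + 1 *: delta_mx i j.
  have U1 : upper u1.
    by apply: upper_add; [exact: upper1 | apply: upper_delta; rewrite wi wj ltnW].
  have U2 : upper u2.
    by do 3 (apply: upper_add; last by apply: upper_delta; rewrite // ltnW); exact: upper1.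
  have [x xE] := cell_pointP w U1 U2.
  suff -> : wmx u + t *: delta_mx (w i) i = cell_point w x by rewrite f0 mul0r.
  rewrite xE uE wmx_tperm // /u1 /u2 mulmxDl mul1mx -scalemxAl delta_wmx.
  rewrite !mulmxDr !mulmx1 -!scalemxAr !mulmxDl -!scalemxAl !wmx_delta.
  rewrite !mul_delta_mx !mul_delta_mx_0 //.
  by apply/matrixP => k l; rewrite !mxE; field.
by rewrite mulf_eq0 polyX_eq0 orbF => /eqP.
Qed.

Lemma cell_closure_bruhat u w : bruhat_le u w -> cell_closure w (wmx u).
Proof.
move=> /connectP[p]; elim: p u => [|z p IH] u /=; first by move=> _ ->; exact: cell_closure_wmx.
move=> /andP[/cell_closure_step uz pz] wE; exact: cell_closure_sub (IH z pz wE) uz.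
Qed.

Definition diag_pred (A : pred 'I_n) : 'M[K]_n := \matrix_(k, l) ((k == l) && A k)%:R.

Lemma mul_diag_pred A M k l : (diag_pred A *m M) k l = (A k)%:R * M k l.
Proof.
rewrite mxE (bigD1 k) //= big1 ?addr0 => [|m mk]; first by rewrite mxE eqxx.
by rewrite mxE eq_sym (negbTE mk) mul0r.
Qed.

Lemma mul_diag_predr A M k l : (M *m diag_pred A) k l = M k l * (A l)%:R.
Proof.
rewrite mxE (bigD1 l) //= big1 ?addr0 => [|m mk]; first by rewrite mxE eqxx.
by rewrite mxE (negbTE mk) mulr0.
Qed.

Lemma rank_diag_pred_le A : (\rank (diag_pred A) <= #|A|)%N.
Proof.
have -> : diag_pred A = \sum_(k | A k) delta_mx k k.
  apply/matrixP => i j; rewrite summxE mxE; have [Ai|nAi] := boolP (A i).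
    rewrite (bigD1 i) //= mxE eqxx big1 ?addr0 ?andbT 1?eq_sym // => k /andP[_ ki].
    by rewrite mxE [i == k]eq_sym (negbTE ki).
  rewrite andbF big1 // => k Ak; rewrite mxE; case: eqP => // ik.
  by rewrite ik Ak in nAi.
apply: leq_trans (_ : \sum_(k | A k) \rank (delta_mx k k : 'M[K]_n) <= _)%N.
  elim/big_rec2: _ => [|k r M _ le]; first by rewrite mxrank0.
  by apply: leq_trans (mxrank_add _ _) _; rewrite leq_add2l.
by under eq_bigr do rewrite mxrank_delta; rewrite sum1_card.
Qed.

Lemma rank_diag_pred A : \rank (diag_pred A) = #|A|.
Proof.
apply/eqP; rewrite eqn_leq rank_diag_pred_le /=.
have := mxrank_add (diag_pred A) (diag_pred (predC A)).
have -> : diag_pred A + diag_pred (predC A) = 1%:M.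
  apply/matrixP => i j; rewrite !mxE /=.
  by case: (A i); rewrite /= andbT andbF ?addr0 ?add0r.
rewrite mxrank1 => le; rewrite -(leq_add2r #|predC A|) cardC card_ord.
by apply: leq_trans le _; rewrite leq_add2l rank_diag_pred_le.
Qed.

Definition corner_rank w (i c : nat) : nat := #|[pred l : 'I_n | (i <= w l)%N && (l < c)%N]|.

Definition corner (i c : nat) M : 'M[K]_n :=
  diag_pred (fun k : 'I_n => (i <= k)%N) *m M *m diag_pred (fun l : 'I_n => (l < c)%N).

Lemma rank_corner_wmx w i c : \rank (corner i c (wmx w)) = corner_rank w i c.
Proof.
have -> : corner i c (wmx w) = wmx w *m diag_pred [pred l : 'I_n | (i <= w l)%N && (l < c)%N].
  apply/matrixP => k l; rewrite !mul_diag_predr mul_diag_pred wmxE /=.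
  by case: eqP => [->|_]; rewrite ?mulr0 ?mul0r // mulr1 mul1r -natrM mulnb.
by rewrite eqmxMfull ?rank_diag_pred // row_full_unit wmx_unit.
Qed.

(** Upper triangular factors on the left combine the rows of index at least [i] among themselves;
    with the column version that follows, they cannot raise the rank of a lower left corner. *)
Lemma mul_diag_pred_upper (a : 'M[K]_n) (i : nat) : upper a ->
  diag_pred (fun k : 'I_n => (i <= k)%N) *m a =
  diag_pred (fun k : 'I_n => (i <= k)%N) *m a *m diag_pred (fun k : 'I_n => (i <= k)%N).
Proof.
move=> ua; apply/matrixP => k l; rewrite mul_diag_predr mul_diag_pred.
have [ik|] := leqP i k; last by rewrite !mul0r.
have [kl|/ua ->] := leqP k l; last by rewrite !(mulr0, mul0r).
by rewrite (leq_trans ik kl) mulr1.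
Qed.

Lemma upper_mul_diag_pred (b : 'M[K]_n) (c : nat) : upper b ->
  b *m diag_pred (fun l : 'I_n => (l < c)%N) =
  diag_pred (fun l : 'I_n => (l < c)%N) *m b *m diag_pred (fun l : 'I_n => (l < c)%N).
Proof.
move=> ub; apply/matrixP => k l; rewrite !mul_diag_predr mul_diag_pred.
have [lc|] := ltnP l c; last by rewrite !mulr0.
have [kl|/ub ->] := leqP k l; last by rewrite !(mulr0, mul0r).
by rewrite (leq_ltn_trans kl lc) mul1r.
Qed.

Lemma rank_corner_cell_point w x i c :
  (\rank (corner i c (cell_point w x)) <= corner_rank w i c)%N.
Proof.
rewrite -rank_corner_wmx /corner /cell_point !mulmxA.
rewrite mul_diag_pred_upper; last exact: upper_upper_of.
rewrite -[X in (\rank X <= _)%N]mulmxA upper_mul_diag_pred; last exact: upper_upper_of.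
rewrite -!mulmxA; apply: leq_trans (mxrankM_maxr _ _) _.
apply: leq_trans (mxrankM_maxr _ _) _; rewrite !mulmxA.
by apply: leq_trans (mxrankM_maxl _ _) _; exact: mxrankM_maxl.
Qed.

(** The polynomial [det (p M q)] plays the role of a minor: it is 1 at [A] and vanishes at every [M]
    of smaller rank. *)
Lemma rank_unit_factor m (A : 'M[K]_m) :
  exists (p : 'M_(\rank A, m)) (q : 'M_(m, \rank A)), p *m A *m q = 1%:M.
Proof.
exists (pinvmx (col_base A)), (pinvmx (row_base A)).
have -> : pinvmx (col_base A) *m A = row_base A.
  transitivity (pinvmx (col_base A) *m (col_base A *m row_base A)); first by rewrite mulmx_base.
  by rewrite mulmxA mulVpmx ?mul1mx // col_base_full.
by rewrite mulmxVp // row_base_free.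
Qed.

Lemma rank_corner_closure w g i c : cell_closure w g ->
  (\rank (corner i c g) <= corner_rank w i c)%N.
Proof.
move=> cg; have [p [q pq]] := rank_unit_factor (corner i c g).
rewrite leqNgt; apply/negP => lt.
pose f M := \det (p *m corner i c M *m q).
have pf : poly f.
  have const m m' (A : 'M_(m, m')) : mx_class poly (fun=> A) := mx_class_const (fun_ringC _) A.
  have mul := mx_class_mul (fun_ringC (entry)).
  apply: (mx_class_det (fun_ringC _)); apply: (mul); last exact: const.
  apply: (mul); first exact: const.
  apply: (mul); last exact: const.
  by apply: (mul); [exact: const | exact: mx_class_entry].
have : f g = 0.
  apply: cg => // x; apply/eqP; rewrite -[_ == _]negbK -unitfE -unitmxE.
  apply/negP => /mxrank_unit r; have := rank_corner_cell_point w x i c.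
  rewrite leqNgt; move/negP; apply; apply: leq_trans lt _; rewrite -[X in (X <= _)%N]r.
  by apply: leq_trans (mxrankM_maxl _ _) _; exact: mxrankM_maxr.
by rewrite /f pq det1 => /eqP; rewrite oner_eq0.
Qed.

Lemma corner_rankS w i (l : 'I_n) :
  corner_rank w i l.+1 = ((i <= w l)%N + corner_rank w i l)%N.
Proof.
rewrite /corner_rank (cardD1 l) inE ltnSn andbT; congr addn.
apply: eq_card => k; rewrite !inE ltnS [in RHS]ltn_neqAle.
by rewrite -val_eqE /=; case: (k == l :> nat); rewrite ?andbF.
Qed.

Lemma corner_rank_inj u w : (forall i c, corner_rank u i c = corner_rank w i c) -> u = w.
Proof.
move=> e; apply/permP => l; have le i : (i <= u l)%N = (i <= w l)%N.
  have := e i l.+1; rewrite !corner_rankS e => /addIn.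
  by case: (i <= u l)%N; case: (i <= w l)%N.
by apply/val_inj/eqP; rewrite eqn_leq /= -le leqnn le leqnn.
Qed.

(* The ranks of the lower left corners are lower semicontinuous and determine [w]. *)
Lemma cell_closure_anti u w : bruhat_le u w -> cell_closure u (wmx w) -> u = w.
Proof.
move=> /cell_closure_bruhat uw wu; apply: corner_rank_inj => i c; apply/eqP.
rewrite eqn_leq -{1}rank_corner_wmx (rank_corner_closure _ _ uw).
by rewrite -{1}(rank_corner_wmx w) (rank_corner_closure _ _ wu).
Qed.

End MatrixSchubert.

(** * Slices of opposite cells *)

Section Slice.
Variables (K : numFieldType) (n : nat).
Local Open Scope ring_scope.
Implicit Types (v w : 'S_n) (a b g h x y M : 'M[K]_n) (f : 'M[K]_n -> K).
Local Notation poly := (fun_ring (@entry K n)).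

Lemma upper_diag_neq0 b i : upper b -> b \in unitmx -> b i i != 0.
Proof.
move=> ub; rewrite unitmxE unitfE -det_tr det_trig; last first.
  by apply/is_trig_mxP => k l kl; rewrite mxE ub.
by move=> /prodf_neq0/(_ i isT); rewrite mxE.
Qed.

Lemma upper_inv b : upper b -> b \in unitmx -> upper (invmx b).
Proof.
move=> ub unb i j; have [m] := ubnP (n - i)%N; elim: m i => // m IH i im ji.
have /matrixP/(_ i j) := mulmxV unb; rewrite !mxE -val_eqE /= gtn_eqF // (bigD1 i) //=.
rewrite big1 ?addr0 => [/eqP|k ki].
  by rewrite mulf_eq0 (negbTE (upper_diag_neq0 _ ub unb)) => /eqP.
have [ik|ki'] := ltnP i k; last first.
  by rewrite ub ?mul0r // ltn_neqAle ki' andbT; exact: ki.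
by rewrite IH ?mulr0 //; [have := ltn_ord k; move: im ik; lia | exact: ltn_trans ik].
Qed.

(** These are the entries left free by the group [v U_- v^-1] and by its intersections with [U_-]
    and [U]. The first intersection parametrizes the opposite cell of [v], the second its Schubert
    cell, of dimension [l(v)]. *)
Definition position_order v : rel 'I_n := fun i j => ((v^-1)%g j < (v^-1)%g i)%N.
Definition low_pattern v : rel 'I_n := fun i j => position_order v i j && (j < i)%N.
Definition up_pattern v : rel 'I_n := fun i j => position_order v i j && (i < j)%N.

Lemma position_order_trans v : transitive (position_order v).
Proof. by move=> j i k ji kj; exact: ltn_trans kj ji. Qed.

Lemma low_pattern_trans v : transitive (low_pattern v).
Proof.
move=> j i k /andP[p ij] /andP[q jk]; rewrite /low_pattern (position_order_trans p q).
exact: ltn_trans jk ij.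
Qed.

Lemma up_pattern_trans v : transitive (up_pattern v).
Proof.
move=> j i k /andP[p ij] /andP[q jk]; rewrite /up_pattern (position_order_trans p q).
exact: ltn_trans ij jk.
Qed.

Lemma position_order_rank v i j : position_order v i j ->
  ((fun i => (v^-1)%g i : nat) j < (fun i => (v^-1)%g i : nat) i)%N.
Proof. by []. Qed.

Lemma low_pattern_rank v i j : low_pattern v i j ->
  ((fun i => (v^-1)%g i : nat) j < (fun i => (v^-1)%g i : nat) i)%N.
Proof. by case/andP. Qed.

Lemma up_pattern_rank v i j : up_pattern v i j ->
  ((fun i => (v^-1)%g i : nat) j < (fun i => (v^-1)%g i : nat) i)%N.
Proof. by case/andP. Qed.

Lemma up_pattern_upper v x : unipotent_on (up_pattern v) x -> upper x.
Proof.
move=> ux i j ji; rewrite ux; first by rewrite -val_eqE /= gtn_eqF.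
by rewrite /up_pattern negb_and -[(i < j)%N]negbK -leqNgt ltnW ?orbT.
Qed.

(* [h v^-1], so that [frame (x v) = x] for [x] in the slice. *)
Definition frame v h : 'M[K]_n := \matrix_(i, j) h i ((v^-1)%g j).

Lemma frame_mul v a h : frame v (a *m h) = a *m frame v h.
Proof. by apply/matrixP => i j; rewrite !mxE; apply: eq_bigr => k _; rewrite mxE. Qed.

Lemma mul_wmxr x v i j : (x *m wmx K v) i j = x i (v j).
Proof.
rewrite mxE (bigD1 (v j)) //= wmxE eqxx mulr1 big1 ?addr0 // => k ki.
by rewrite wmxE eq_sym (negbTE ki) mulr0.
Qed.

Lemma mul_wmxl M v i j : (wmx K v *m M) i j = M ((v^-1)%g i) j.
Proof.
rewrite mxE (bigD1 ((v^-1)%g i)) //= wmxE permKV eqxx mul1r big1 ?addr0 // => k ki.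
by rewrite wmxE -(inj_eq (@perm_inj _ (v^-1)%g)) permK (negbTE ki) mul0r.
Qed.

Lemma frame_wmx v x : frame v (x *m wmx K v) = x.
Proof. by apply/matrixP => i j; rewrite mxE mul_wmxr permKV. Qed.

(** The proper leading principal minors of [v^-1 h] are nonzero; for invertible [h] this is the open
    set [v B_- B]. *)
Definition good v h : Prop := elim_ok (position_order v) (frame v h).

(* [A h = v R] with [R] upper triangular and [A] in v U_- v^-1; then [A = X^-1 Y] with
   [X] lower and [Y] upper triangular in the same group, so that [Y h = X v R]. *)
Definition Amx v h : 'M[K]_n := elim_mx (position_order v) (frame v h).
Definition Xmx v h : 'M[K]_n := elim_mx (low_pattern v) (Amx v h).
Definition Ymx v h : 'M[K]_n := Xmx v h *m Amx v h.
Definition slice v h : 'M[K]_n := Xmx v h *m wmx K v.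
Definition Rmx v h : 'M[K]_n := \matrix_(i, j) (Amx v h *m h) (v i) j.

Section Good.
Variables (v : 'S_n) (h : 'M[K]_n).
Hypothesis gh : good v h.

Lemma Amx_unipotent : unipotent_on (position_order v) (Amx v h).
Proof. exact: elim_mx_unipotent. Qed.

Lemma low_elim_ok : elim_ok (low_pattern v) (Amx v h).
Proof. exact: (elim_ok_unipotent (@position_order_rank v) _ Amx_unipotent). Qed.

Lemma Xmx_unipotent : unipotent_on (low_pattern v) (Xmx v h).
Proof. exact/elim_mx_unipotent/low_elim_ok. Qed.

Lemma Ymx_unipotent : unipotent_on (up_pattern v) (Ymx v h).
Proof.
move=> i j nP; have uY : unipotent_on (position_order v) (Ymx v h).
  apply: (unipotent_mul (@position_order_rank v)).
  - exact: position_order_trans.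
  - by apply: sub_unipotent Xmx_unipotent => k l /andP[].
  - exact: Amx_unipotent.
have [Qij|/uY //] := boolP (position_order v i j).
have ji : (j < i)%N.
  move: nP; rewrite /up_pattern Qij /= -leqNgt leq_eqVlt => /orP[/eqP/val_inj e|//].
  by move: Qij; rewrite e /position_order ltnn.
rewrite /Ymx elim_mx_zero ?(negbTE _) //; first by rewrite -val_eqE /= gtn_eqF.
  exact: low_elim_ok.
by rewrite /low_pattern Qij.
Qed.

Lemma Rmx_upper : upper (Rmx v h).
Proof.
move=> i j ji; rewrite mxE.
have := elim_mx_zero (i := v i) (j := v j) gh; rewrite -frame_mul mxE permK; apply.
by rewrite /position_order !permK.
Qed.

Lemma Amx_eq : Amx v h *m h = wmx K v *m Rmx v h.
Proof. by apply/matrixP => i j; rewrite mul_wmxl [RHS]mxE permKV. Qed.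

Lemma Ymx_eq : Ymx v h *m h = slice v h *m Rmx v h.
Proof. by rewrite /Ymx /slice -!mulmxA Amx_eq. Qed.

Lemma Rmx_unit : h \in unitmx -> Rmx v h \in unitmx.
Proof.
move=> uh; have : Amx v h *m h \in unitmx.
  by rewrite unitmx_mul uh (unipotent_unit (@position_order_rank v) Amx_unipotent).
by rewrite Amx_eq unitmx_mul => /andP[].
Qed.

Lemma slice_eq : h \in unitmx -> slice v h = Ymx v h *m h *m invmx (Rmx v h).
Proof. by move=> /Rmx_unit uR; rewrite Ymx_eq mulmxK. Qed.

Lemma slice_eqV : h \in unitmx -> h = invmx (Ymx v h) *m slice v h *m Rmx v h.
Proof.
move=> uh; rewrite -mulmxA -Ymx_eq mulKmx //.
exact: (unipotent_unit (@up_pattern_rank v) Ymx_unipotent).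
Qed.

End Good.

Lemma good_mul_upper v h b : upper b -> b \in unitmx -> good v h -> good v (h *m b).
Proof.
move=> ub unb gh i; pose b' := \matrix_(k, j) b ((v^-1)%g k) ((v^-1)%g j).
have -> : frame v (h *m b) = frame v h *m b'.
  apply/matrixP => k j; rewrite !mxE (reindex_inj (@perm_inj _ (v^-1)%g)) /=.
  by apply: eq_bigr => l _; rewrite !mxE.
rewrite restrict_mx_mul => [|k j nk Qj]; last first.
  rewrite mxE ub //; apply: leq_trans Qj _; rewrite leqNgt; exact: nk.
rewrite unitmx_mul gh /=.
apply: (@unitmx_of_rank _ _ (fun k => n - (v^-1)%g k)%N) => [k|k j kj].
  by rewrite !mxE eqxx; case: ifP => _; rewrite ?oner_eq0 // upper_diag_neq0.
rewrite !mxE (negbTE kj); case: ifP => _; rewrite ?eqxx // => nz.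
have : ((v^-1)%g k <= (v^-1)%g j)%N.
  by rewrite leqNgt; apply: contra nz => /ub ->.
have : (v^-1)%g k != (v^-1)%g j by rewrite (inj_eq perm_inj).
rewrite -val_eqE /=; have := ltn_ord ((v^-1)%g j); lia.
Qed.

(** From [A h = v R] follows [A h b = v (R b)] with [R b] upper triangular, and elimination is
    unique. Hence [X] and [Y] are functions of the flag. *)
Lemma Amx_mul_upper v h b : upper b -> b \in unitmx -> good v h -> Amx v (h *m b) = Amx v h.
Proof.
move=> ub unb gh; apply/esym/elim_mxE.
- by move=> i; rewrite /position_order ltnn.
- exact: good_mul_upper.
- exact: Amx_unipotent.
move=> i j Qij; rewrite -frame_mul mulmxA Amx_eq // -mulmxA mxE mul_wmxl.
exact: (upper_mul (Rmx_upper gh) ub).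
Qed.

Lemma slice_mul_upper v h b : upper b -> b \in unitmx -> good v h ->
  slice v (h *m b) = slice v h /\ Ymx v (h *m b) = Ymx v h.
Proof. by move=> ub unb gh; rewrite /slice /Ymx /Xmx Amx_mul_upper. Qed.

(** Here [A = x^-1 y], since [A h = v], and uniqueness of elimination gives the rest. The entries of
    [x] and [y] are therefore independent coordinates. *)
Lemma slice_unique v x y : unipotent_on (low_pattern v) x -> unipotent_on (up_pattern v) y ->
  let h := invmx y *m x *m wmx K v in
  [/\ good v h, slice v h = x *m wmx K v & Ymx v h = y].
Proof.
move=> ux uy h.
have uyV : unipotent_on (up_pattern v) (invmx y).
  exact: (unipotent_inv (@up_pattern_rank v) (@up_pattern_trans v)).
have uxV : unipotent_on (low_pattern v) (invmx x).
  exact: (unipotent_inv (@low_pattern_rank v) (@low_pattern_trans v)).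
have lowQ i j : low_pattern v i j -> position_order v i j by case/andP.
have upQ i j : up_pattern v i j -> position_order v i j by case/andP.
have mulQ := unipotent_mul (@position_order_rank v) (@position_order_trans v).
have gh : good v h.
  rewrite /good frame_wmx; apply: (elim_ok_unipotent (@position_order_rank v)).
  by apply: mulQ; [exact: sub_unipotent upQ uyV | exact: sub_unipotent lowQ ux].
have unx := unipotent_unit (@low_pattern_rank v) ux.
have uny := unipotent_unit (@up_pattern_rank v) uy.
have AE : Amx v h = invmx x *m y.
  apply/esym/elim_mxE => //.
  - by move=> i; rewrite /position_order ltnn.
  - by apply: mulQ; [exact: sub_unipotent lowQ uxV | exact: sub_unipotent upQ uy].
  move=> i j Qij; rewrite frame_wmx -mulmxA (mulmxA y) mulmxV // mul1mx mulVmx // mxE.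
  by case: eqP Qij => // ->; rewrite /position_order ltnn.
have XE : Xmx v h = x.
  apply/esym/elim_mxE => //.
  - by move=> i; rewrite /low_pattern ltnn andbF.
  - exact: low_elim_ok.
  move=> i j /andP[Qij ji]; rewrite AE mulmxA mulmxV // mul1mx uy.
    by rewrite -val_eqE /= gtn_eqF.
  by rewrite /up_pattern Qij /= -leqNgt ltnW.
by split=> //; rewrite /slice /Ymx XE // AE mulmxA mulmxV // mul1mx.
Qed.

Section TriangularFactor.
Variables (O : rel 'I_n) (r : 'I_n -> nat).
Hypothesis Orank : forall i j, O i j = (r j < r i)%N.

(** Stated for an order [O] so as to serve both Borel subgroups. Eliminating in [b] the entries of
    [O] that [w] places below the diagonal leaves a matrix whose conjugate by [w] is upper
    triangular. *)
Lemma triangular_factor w b :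
  (forall i j, i != j -> ~~ O i j -> b i j = 0) -> (forall i, b i i != 0) ->
  exists x R, [/\ unipotent_on (fun i j => position_order w i j && O i j) x, upper R &
    b *m wmx K w = x *m wmx K w *m R].
Proof.
move=> bO db; set P := fun i j => position_order w i j && O i j.
have Prank i j : P i j -> (r j < r i)%N by rewrite /P Orank => /andP[].
have Ptrans : transitive P.
  move=> j i k /andP[p ij] /andP[q jk]; apply/andP; split.
    exact: position_order_trans p q.
  by move: ij jk; rewrite !Orank => ij jk; exact: ltn_trans jk ij.
have ok : elim_ok P b.
  move=> i; apply: (@unitmx_of_rank _ _ r) => [k|k j kj].
    by rewrite mxE eqxx; case: ifP => _; rewrite ?oner_eq0.
  rewrite mxE (negbTE kj); case: ifP => _; last by rewrite eqxx.
  by apply: contraNT; rewrite -Orank => /(bO _ _ kj) ->.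
pose X := elim_mx P b.
have uX : unipotent_on P X by exact: elim_mx_unipotent.
have XO i j : i != j -> ~~ O i j -> (X *m b) i j = 0.
  move=> ij nO; rewrite mxE big1 // => k _.
  have [<-|ik] := eqVneq i k; first by rewrite bO ?mulr0.
  have [Oik|nOik] := boolP (O i k); last first.
    by rewrite uX ?(negbTE ik) ?mul0r // /P negb_and nOik orbT.
  rewrite bO ?mulr0 //; first by apply: contraNneq nO => <-.
  by apply: contra nO; rewrite !Orank in Oik * => Okj; exact: ltn_trans Okj Oik.
have unX := unipotent_unit Prank uX.
exists (invmx X), (\matrix_(i, j) (X *m b) (w i) (w j)); split.
- exact: (unipotent_inv Prank Ptrans uX).
- move=> i j ji; rewrite mxE; have [Oij|nO] := boolP (O (w i) (w j)).
    apply: elim_mx_zero => //; apply/andP; split=> //.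
    by rewrite /position_order !permK.
  by apply: XO => //; rewrite (inj_eq perm_inj) -val_eqE /= gtn_eqF.
rewrite -mulmxA; apply: (canRL (mulKmx unX)).
by apply/matrixP => i j; rewrite mulmxA mul_wmxr mul_wmxl [RHS]mxE permKV.
Qed.

End TriangularFactor.

Lemma upper_factor w b : upper b -> b \in unitmx ->
  exists x R, [/\ unipotent_on (up_pattern w) x, upper R & b *m wmx K w = x *m wmx K w *m R].
Proof.
move=> ub unb.
apply: (@triangular_factor (fun i j => (i < j)%N) (fun i => n - i)%N).
- move=> i j /=; have := ltn_ord i; have := ltn_ord j; lia.
- by move=> i j ij; rewrite -leqNgt => ji; apply: ub; rewrite ltn_neqAle ji eq_sym ij.
- by move=> i; exact: upper_diag_neq0.
Qed.

Lemma lower_factor w b : upper b^T -> b \in unitmx ->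
  exists x R, [/\ unipotent_on (low_pattern w) x, upper R & b *m wmx K w = x *m wmx K w *m R].
Proof.
move=> ub unb; apply: (@triangular_factor (fun i j => (j < i)%N) (fun i => i)).
- by [].
- move=> i j ij; rewrite -leqNgt => ji; have := ub j i; rewrite mxE; apply.
  by rewrite ltn_neqAle ji ij.
- by move=> i; have := upper_diag_neq0 i ub; rewrite mxE unitmx_tr; apply.
Qed.

Definition good_det v h : K := \prod_i \det (restrict_mx (position_order v i) (frame v h)).

Lemma good_detP v h : good v h <-> good_det v h != 0.
Proof.
split=> [gh|/prodf_neq0 gh i]; last by rewrite unitmxE unitfE gh.
by apply/prodf_neq0 => i _; rewrite -unitfE -unitmxE.
Qed.

Lemma mx_class_frame v : mx_class poly (frame v).
Proof. by move=> i j; under eq_fun do rewrite mxE; exact: mx_class_entry. Qed.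

Lemma poly_good_det v : poly (good_det v).
Proof.
apply: (class_prod (fun_ringC _)) => i; apply: (mx_class_det (fun_ringC _)).
by apply: (mx_class_restrict (fun_ringC _)); exact: mx_class_frame.
Qed.

Lemma poly_det : poly (fun M => \det M).
Proof. by apply: (mx_class_det (fun_ringC _)); exact: mx_class_entry. Qed.

Local Notation rat v := (rational_on (@entry K n) (good v)).

Lemma rational_Amx v : mx_class (rat v) (Amx v).
Proof.
apply: rational_elim_mx => // i j; apply: rational_ring; exact: mx_class_frame.
Qed.

Lemma rational_Xmx v : mx_class (rat v) (Xmx v).
Proof. by apply: rational_elim_mx; [exact: low_elim_ok | exact: rational_Amx]. Qed.

Lemma rational_Ymx v : mx_class (rat v) (Ymx v).
Proof.
by apply: (mx_class_mul (rationalC _ _)); [exact: rational_Xmx | exact: rational_Amx].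
Qed.

Lemma rational_slice v : mx_class (rat v) (slice v).
Proof.
apply: (mx_class_mul (rationalC _ _)); first exact: rational_Xmx.
exact: (mx_class_const (rationalC _ _)).
Qed.

Lemma rational_poly_slice v f : poly f -> rat v (f \o slice v).
Proof.
by apply: poly_entry_comp; [exact: rationalC | exact: rational_slice].
Qed.

Lemma card_up_pattern w :
  #|[pred p : 'I_n * 'I_n | up_pattern w p.1 p.2]| = inv w.
Proof.
rewrite /inv -(card_imset (mem (inversions w))
  (_ : injective (fun p : 'I_n * 'I_n => (w p.2, w p.1)))).
  apply: eq_card => -[i j]; rewrite [LHS]inE /=; apply/idP/imsetP => /=.
    move=> /andP[ji ij]; exists ((w^-1)%g j, (w^-1)%g i); rewrite ?permKV // inE /=.
    by rewrite !permKV ij andbT; exact: ji.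
  move=> [[k l]]; rewrite !inE /= => /andP[kl lk] [-> ->].
  by rewrite /up_pattern /position_order !permK kl lk.
by move=> [i j] [k l] [/perm_inj -> /perm_inj ->].
Qed.

End Slice.

(** * Slices of Kazhdan-Lusztig varieties and the upper bound for their dimension *)

Section KLSlice.
Variables (K : numFieldType) (n : nat).
Local Open Scope ring_scope.
Implicit Types (u v w : 'S_n) (a b g h x y M : 'M[K]_n) (f : 'M[K]_n -> K).
Local Notation poly := (fun_ring (@entry K n)).

Definition kl_slice v w x : Prop :=
  unipotent_on (low_pattern v) x /\ cell_closure w (x *m wmx K v).

Lemma unipotent1 (P : rel 'I_n) : unipotent_on P (1%:M : 'M[K]_n).
Proof. by move=> i j _; rewrite mxE. Qed.

Lemma slice_point v x : unipotent_on (low_pattern v) x ->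
  [/\ good v (x *m wmx K v), slice v (x *m wmx K v) = x *m wmx K v &
      x *m wmx K v \in unitmx].
Proof.
move=> ux; have := slice_unique ux (@unipotent1 (up_pattern v)).
rewrite /= invmx1 mul1mx => -[gx sx _]; split=> //.
by rewrite unitmx_mul wmx_unit andbT (unipotent_unit (@low_pattern_rank _ v) ux).
Qed.

(** The slice of [h] is [Y h R^-1] with [Y] and [R] upper triangular, and such factors preserve the
    closure. *)
Lemma closure_slice v w h : h \in unitmx -> good v h -> cell_closure w h ->
  kl_slice v w (Xmx v h).
Proof.
move=> uh gh cwh; split; first exact: Xmx_unipotent.
rewrite -/(slice v h) slice_eq //; apply: cell_closure_mul => //.
  exact: (up_pattern_upper (Ymx_unipotent gh)).
by apply: upper_inv; [exact: Rmx_upper | exact: Rmx_unit].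
Qed.

Definition generic_det v h : K := good_det v h * \det h.

Lemma poly_generic_det v : poly (generic_det v).
Proof. by apply: fun_ring_mul; [exact: poly_good_det | exact: poly_det]. Qed.

Lemma generic_detP v h : generic_det v h != 0 <-> good v h /\ h \in unitmx.
Proof.
by rewrite mulf_eq0 negb_or unitmxE unitfE; split=> [/andP[/good_detP]|[/good_detP -> ->]].
Qed.

Lemma generic_det_point v x : unipotent_on (low_pattern v) x ->
  generic_det v (x *m wmx K v) != 0.
Proof. by move=> /slice_point[gx _ ux]; apply/generic_detP. Qed.

(** The slice point [x v] lies in the closure and [generic_det] is nonzero there, so the generic
    cell points are dense. *)
Lemma closure_rational_eq0 v w (F : 'M[K]_n -> K) x :
  rational_on (@entry K n) (good v) F -> kl_slice v w x ->
  (forall t, good v (cell_point w t) -> cell_point w t \in unitmx -> F (cell_point w t) = 0) ->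
  forall h, cell_closure w h -> good v h -> F h = 0.
Proof.
move=> [p [q [pp pq pqF]]] [ux cx] F0 h ch gh.
have [_ ->] := pqF h gh.
rewrite (cell_closure_generic pp (poly_generic_det v) _ cx (generic_det_point ux) ch) ?mul0r //.
move=> t /generic_detP[gt ut]; have [q0 FE] := pqF _ gt.
by move: (F0 t gt ut); rewrite FE => /eqP; rewrite mulf_eq0 invr_eq0 (negbTE q0) orbF => /eqP.
Qed.

(** The slice map carries the generic part of the irreducible closure into the slice and fixes the
    points [x v]. *)
Lemma kl_slice_irreducible v w f f' : poly f -> poly f' ->
  (forall x, kl_slice v w x -> f (x *m wmx K v) * f' (x *m wmx K v) = 0) ->
  (forall x, kl_slice v w x -> f (x *m wmx K v) = 0) \/
  (forall x, kl_slice v w x -> f' (x *m wmx K v) = 0).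
Proof.
move=> pf pf' ff'.
have [p [q [pp pq pqF]]] := rational_poly_slice v pf.
have [p' [q' [pp' pq' pqF']]] := rational_poly_slice v pf'.
(* The factor [generic_det] takes care of the cell points where the slice is not defined. *)
have := @cell_closure_domain _ _ w (fun h => p h * generic_det v h) p'.
case=> [||t|z|z]; [|exact: pp'| | |].
- by apply: fun_ring_mul => //; exact: poly_generic_det.
- have [->|/generic_detP[gt ut]] := eqVneq (generic_det v (cell_point w t)) 0.
    by rewrite mulr0 mul0r.
  have := ff' _ (closure_slice ut gt (@cell_closure_point _ _ w t)).
  have [q0 /= FE] := pqF _ gt; have [q0' /= FE'] := pqF' _ gt.
  rewrite -/(slice v _) FE FE' mulf_div => /eqP.
  rewrite mulf_eq0 invr_eq0 (negbTE (mulf_neq0 q0 q0')) orbF => /eqP pp0.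
  by rewrite mulrAC pp0 mul0r.
- left=> x [ux cx]; have [gx sx _] := slice_point ux.
  have [_ /= FE] := pqF _ gx; rewrite -sx FE.
  have /eqP := z _ cx; rewrite mulf_eq0 (negbTE (generic_det_point ux)) orbF => /eqP ->.
  by rewrite mul0r.
- right=> x [ux cx]; have [gx sx _] := slice_point ux.
  by have [_ /= FE] := pqF' _ gx; rewrite -sx FE z ?mul0r.
Qed.

Lemma kl_slice1 v w : bruhat_le v w -> kl_slice v w 1%:M.
Proof.
move=> vw; split; first exact: unipotent1.
by rewrite mul1mx; exact: cell_closure_bruhat.
Qed.

Lemma cell_point_unit w t : cell_point w t \in unitmx ->
  (upper_of true t : 'M[K]_n) \in unitmx /\ (upper_of false t : 'M[K]_n) \in unitmx.
Proof. by rewrite !unitmx_mul => /andP[/andP[-> _] ->]. Qed.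

(** Take the slice of a generic point of the cell of [w]. If it lay in the closure for [u], then
    undoing the upper triangular factors would put [w] itself there, against [cell_closure_anti]. *)
Lemma kl_slice_strict v u w : bruhat_le v u -> bruhat_le u w -> u != w ->
  exists2 x, kl_slice v w x & ~ cell_closure u (x *m wmx K v).
Proof.
move=> vu uw nuw; have [ux cx] := kl_slice1 (bruhat_le_trans vu uw).
have [t] : exists t, generic_det v (cell_point w t) != 0.
  apply: contrapT => no; have /negP := generic_det_point ux; apply; apply/eqP.
  apply: (cx _ (poly_generic_det v)) => t; apply/eqP; apply: contrapT => /negP nz.
  by apply: no; exists t.
move=> /generic_detP[gt ut]; exists (Xmx v (cell_point w t)).
  by apply: closure_slice => //; exact: cell_closure_point.
rewrite -/(slice v _) => cs; move/negP: nuw; apply; apply/eqP.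
apply: (@cell_closure_anti K n _ _ uw).
have [ua ub] := cell_point_unit ut.
have -> : wmx K w = invmx (upper_of true t) *m cell_point w t *m invmx (upper_of false t).
  by rewrite /cell_point !mulmxA mulmxK // mulVmx // mul1mx.
apply: cell_closure_mul; try by apply: upper_inv => //; exact: upper_upper_of.
rewrite [X in cell_closure u X](slice_eqV gt ut).
apply: cell_closure_mul cs; last exact: Rmx_upper.
apply: upper_inv; first exact: (up_pattern_upper (Ymx_unipotent gt)).
exact: (unipotent_unit (@up_pattern_rank _ v) (Ymx_unipotent gt)).
Qed.

Section DimensionBound.
Variables (v w : 'S_n) (d : nat) (f : nat -> 'M[K]_n -> K) (x0 : 'M[K]_n).
Hypothesis pf : forall i, poly (f i).
Hypothesis x0P : kl_slice v w x0.
Hypothesis ind : independent_on (kl_slice v w) d (fun i x => f i (x *m wmx K v)).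

Let positions := enum [pred p : 'I_n * 'I_n | up_pattern v p.1 p.2].

(** The free entries of [Y] in a fixed enumeration, continued by zero. In [pair_fun] and [coord_fun]
    they come after the [d] slice functions. *)
Let entry_at (k : nat) y : K :=
  if nth None (map Some positions) k is Some p then y p.1 p.2 else 0.

Let pair_fun (k : nat) (xy : 'M[K]_n * 'M[K]_n) : K :=
  if (k < d)%N then f k (xy.1 *m wmx K v) else entry_at (k - d) xy.2.

Let coord_fun (k : nat) h : K :=
  if (k < d)%N then f k (slice v h) else entry_at (k - d) (Ymx v h).

Lemma size_positions : size positions = inv v.
Proof. by rewrite -cardE card_up_pattern. Qed.

Lemma position_at k : (k < inv v)%N -> exists p, [/\ nth None (map Some positions) k = Some p,
  up_pattern v p.1 p.2 & index p positions = k].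
Proof.
rewrite -size_positions => kn.
case E: positions kn => [//|p0 s] kn; rewrite -E in kn *; clear E.
exists (nth p0 positions k); split; first by rewrite (nth_map p0).
  by have := mem_nth p0 kn; rewrite mem_enum.
by rewrite index_uniq // enum_uniq.
Qed.

Lemma entry_at_default k y : (inv v <= k)%N -> entry_at k y = 0.
Proof. by move=> vk; rewrite /entry_at nth_default // size_map size_positions. Qed.

Lemma entry_at1 k : entry_at k 1%:M = 0.
Proof.
have [vk|kv] := leqP (inv v) k; first exact: entry_at_default.
have [p [pE upp _]] := position_at kv; rewrite /entry_at pE mxE.
by case: eqP upp => // ->; rewrite /up_pattern ltnn andbF.
Qed.

(** The entries of [y] are released one at a time: those of index at least [j] are still zero, and
    the next one can take any value without affecting the functions before it. *)
Lemma pair_independent j : (j <= inv v)%N ->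
  independent_on (fun xy => [/\ kl_slice v w xy.1, unipotent_on (up_pattern v) xy.2 &
    forall k, (j <= k)%N -> entry_at k xy.2 = 0]) (d + j)%N pair_fun.
Proof.
elim: j => [_|j IH jv].
  rewrite addn0; apply: independent_pullback ind => x kx.
  exists (x, 1%:M); last by move=> i id; rewrite /pair_fun id.
  by split=> //; [exact: unipotent1 | move=> k _; exact: entry_at1].
rewrite addnS; apply: independent_free (IH (ltnW jv)) => -[x y] t [/= kx uy y0].
have [p [pE upp pI]] := position_at jv.
pose y' : 'M[K]_n := \matrix_(a, b) if (a, b) == p then t else y a b.
have entry_y' k : k != j -> entry_at k y' = entry_at k y.
  move=> kj; have [vk|kv] := leqP (inv v) k; first by rewrite !entry_at_default.
  have [q [qE upq qI]] := position_at kv; rewrite /entry_at qE mxE -surjective_pairing.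
  by case: eqP => // qp; move: kj; rewrite -qI -pI qp eqxx.
exists (x, y'); split=> /=.
- split=> // [a b nP|k jk]; last by rewrite entry_y' ?y0 ?gtn_eqF // ltnW.
  by rewrite mxE; case: eqP => [e|_]; [rewrite -e in upp; rewrite upp in nP | exact: uy].
- rewrite /pair_fun ltnNge leq_addr /= addKn /entry_at pE mxE.
  by rewrite -surjective_pairing eqxx.
- move=> i ij; rewrite /pair_fun; case: ltnP => //= di.
  by rewrite entry_y' //; lia.
Qed.

Lemma coord_independent : independent_on
  (fun h => [/\ cell_closure w h, good v h & h \in unitmx]) (d + inv v)%N coord_fun.
Proof.
apply: independent_pullback (pair_independent (leqnn _)) => -[x y] [/= [ux cx] uy _].
have [gh sh yh] := slice_unique ux uy.
have uyV : unipotent_on (up_pattern v) (invmx y).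
  exact: (unipotent_inv (@up_pattern_rank _ v) (@up_pattern_trans _ v)).
exists (invmx y *m x *m wmx K v); last first.
  by move=> i _; rewrite /coord_fun /pair_fun sh yh.
split=> //.
  rewrite -mulmxA -[_ *m (_ *m _)]mulmx1; apply: cell_closure_mul => //.
    exact: up_pattern_upper uyV.
  exact: upper1.
rewrite !unitmx_mul wmx_unit (unipotent_unit (@up_pattern_rank _ v) uyV).
by rewrite (unipotent_unit (@low_pattern_rank _ v) ux).
Qed.

Lemma rational_coord_fun k : rational_on (@entry K n) (good v) (coord_fun k).
Proof.
rewrite /coord_fun; under eq_fun do rewrite (fun_if (fun z => z)).
case: (k < d)%N; first exact: rational_poly_slice.
rewrite /entry_at; case: (nth _ _ _) => [p|]; first exact: rational_Ymx.
exact: (class_const (rationalC _ _)).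
Qed.

Lemma coord_fun_mul_upper k h b : upper b -> b \in unitmx -> good v h ->
  coord_fun k (h *m b) = coord_fun k h.
Proof.
by move=> ub unb gh; rewrite /coord_fun; have [-> ->] := slice_mul_upper ub unb gh.
Qed.

Let cell_coordinate : finType := {p : 'I_n * 'I_n | up_pattern w p.1 p.2}.

Let cell_mx (t : cell_coordinate -> K) : 'M[K]_n :=
  \matrix_(i, j) if insub (i, j) is Some p then t p else (i == j)%:R.

Lemma cell_mxP x : unipotent_on (up_pattern w) x -> exists t, cell_mx t = x.
Proof.
move=> ux; exists (fun p => x (val p).1 (val p).2); apply/matrixP => i j; rewrite mxE.
by case: insubP => [p _ -> //|nP]; rewrite ux.
Qed.

(** The map [cell_point] has too many parameters for a sharp count. Invariance under upper
    triangular factors on the right reduces a generic cell point to its unipotent normal form, with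
    [l(w)] coordinates; a relation there holds at generic cell points, hence on the closure by
    density. *)
Lemma cell_independent : independent_on (fun t => good v (cell_mx t *m wmx K w))
  (d + inv v)%N (fun k t => coord_fun k (cell_mx t *m wmx K w)).
Proof.
move=> N c c0; apply: coord_independent => h [ch gh _].
pose F h := \sum_a c a * monomial coord_fun a h.
rewrite -/(F h); apply: (closure_rational_eq0 _ x0P _ ch gh).
  apply: (class_sum (rationalC _ _)) => a; apply: (class_mul (rationalC _ _)).
    exact: (class_const (rationalC _ _)).
  by apply: monomial_class => [|i _]; [exact: rationalC | exact: rational_coord_fun].
move=> t gt ut; have [ua ub] := cell_point_unit ut.
have [x [r [ux ur xr]]] := upper_factor w (upper_upper_of true t) ua.
have [s sE] := cell_mxP ux.
have pE : cell_point w t = cell_mx s *m wmx K w *m (r *m upper_of false t).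
  by rewrite /cell_point xr sE !mulmxA.
have uR : upper (r *m upper_of false t) by apply: upper_mul => //; exact: upper_upper_of.
have unR : r *m upper_of false t \in unitmx.
  by move: ut; rewrite pE unitmx_mul => /andP[].
have gs : good v (cell_mx s *m wmx K w).
  rewrite -[_ *m wmx K w](mulmxK unR) -pE; apply: good_mul_upper => //.
    exact: upper_inv.
  by rewrite unitmx_inv.
rewrite -[RHS](c0 s gs) /F; apply: eq_bigr => a _; congr (_ * _).
by apply: eq_monomial => i _; rewrite pE coord_fun_mul_upper.
Qed.

Lemma kl_slice_bound : (d + inv v <= inv w)%N.
Proof.
have -> : inv w = #|cell_coordinate| by rewrite card_sig card_up_pattern.
apply: independent_bound cell_independent => k _.
apply: (rational_comp _ (rational_coord_fun k)) => _ [i [j ->]].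
apply: (mx_class_mul (fun_ringC _)); last exact: (mx_class_const (fun_ringC _)).
move=> a b; under eq_fun do rewrite mxE.
case: (insub (a, b)) => [p|]; last exact: fun_ring_const.
by apply: fun_ring_gen; exists p.
Qed.

End DimensionBound.

End KLSlice.

(** * Kazhdan-Lusztig varieties in the flag variety *)

Section Flags.
Variables (R : realType) (n : nat).
Local Open Scope classical_set_scope.
Local Open Scope ring_scope.
Local Open Scope complex_scope.
Local Notation K := R[i].
Implicit Types (u v w : 'S_n) (g h : GL R n) (x M : 'M[K]_n) (f : 'M[K]_n -> K).
Local Notation poly := (fun_ring (@entry K n)).
Local Notation KL := (@kazhdan_lusztig_variety R n).

Lemma poly_eval_entries (p : mpoly.mpoly (n * n) K) :
  exists2 f, poly f & forall g, eval_entries p g = f (val g).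
Proof.
exists (fun M => mpoly.meval (fun k => mxvec M 0 k) p) => //.
under eq_fun do rewrite mpoly.mevalE.
apply: (class_sum (fun_ringC _)) => m; apply: (class_mul (fun_ringC _)).
  exact: fun_ring_const.
apply: (class_prod (fun_ringC _)) => k; apply: (class_exp (fun_ringC _)).
by case/mxvec_indexP: k => i j; under eq_fun do rewrite mxvecE; exact: mx_class_entry.
Qed.

Lemma eval_entries_poly f : poly f ->
  exists p : mpoly.mpoly (n * n) K, forall g, eval_entries p g = f (val g).
Proof.
elim=> {f} [_ [i [j ->]]|c|f f' _ [p pE] _ [p' pE']|f f' _ [p pE] _ [p' pE']].
- exists (mpoly.mpolyX _ (mpoly.mnm1 (mxvec_index i j))) => g.
  by rewrite /eval_entries mpoly.mevalXU mxvecE.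
- by exists (mpoly.mpolyC _ c) => g; rewrite /eval_entries mpoly.mevalC.
- by exists (p + p') => g; rewrite -pE -pE' /eval_entries mpoly.mevalD.
- by exists (p * p') => g; rewrite -pE -pE' /eval_entries mpoly.mevalM.
Qed.

Lemma flag_ofP g h : flag_of g = flag_of h <->
  exists b, [/\ upper b, b \in unitmx & val h = val g *m b].
Proof.
split=> [/eqquotP/asboolP e|[b [ub unb hE]]].
  have : coset_up h (val h).
    by exists (mkGL (unitmx1 K n)); [exact: upper1 | rewrite /= mulmx1].
  by rewrite -e => -[b ub <-]; exists (val b); split=> //; exact: (valP b).
apply/eqquotP/asboolP/seteqP; split=> [_ [c uc <-]|_ [c uc <-]].
  have un : invmx b *m val c \in unitmx by rewrite unitmx_mul unitmx_inv unb (valP c).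
  exists (mkGL un); last by rewrite /= hE -mulmxA (mulKVmx unb).
  by apply: upper_mul => //; exact: upper_inv.
have un : b *m val c \in unitmx by rewrite unitmx_mul unb (valP c).
exists (mkGL un); last by rewrite /= hE -mulmxA.
exact: upper_mul.
Qed.

Lemma closed_separated (F : set (flag_variety R n)) g : closed F -> ~ F (flag_of g) ->
  exists f, [/\ poly f, f (val g) != 0 & forall h, F (flag_of h) -> f (val h) = 0].
Proof.
rewrite -openC => oF nF.
(* In the quotient topology a set of flags is open when its preimage in [GL] is. *)
have : @zariski_open R n (@flag_of R n @^-1` ~` F) by exact: oF.
move=> [P PE].
have : (@flag_of R n @^-1` ~` F) g by [].
rewrite PE => -[p Pp]; have [f pf fE] := poly_eval_entries p.
rewrite fE => fg; exists f; split=> // h Fh; apply/eqP; apply: contrapT => /negP fh.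
have : (@flag_of R n @^-1` ~` F) h by rewrite PE; exists p; rewrite ?fE.
by apply.
Qed.

Lemma closed_of_equations (S : set (flag_variety R n)) (P : set ('M[K]_n -> K)) :
  P `<=` poly -> (forall g, S (flag_of g) <-> forall f, P f -> f (val g) = 0) -> closed S.
Proof.
move=> Ppoly SP; rewrite -openC.
suff : @zariski_open R n (@flag_of R n @^-1` ~` S) by [].
exists [set p | exists2 f, P f & forall g, eval_entries p g = f (val g)].
apply/seteqP; split=> g /=.
  move=> nS; apply: contrapT => no; apply: nS; apply/SP => f Pf.
  have [p pE] := eval_entries_poly (Ppoly f Pf).
  apply/eqP; apply: contrapT => /negP fg; apply: no; exists p; first by exists f.
  by rewrite pE.
by move=> [p [f Pf pE]]; rewrite pE => fg /SP/(_ f Pf) fg0; rewrite fg0 eqxx in fg.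
Qed.

Lemma closure_cellP w g : closure (schubert_cell (R := R) w) (flag_of g) <->
  cell_closure w (val g).
Proof.
split=> [|cg].
  (* All representatives are quantified over in order to define a set of flags; one of them decides,
     because the closure is stable under upper triangular factors. *)
  pose S := [set p : flag_variety R n | forall h, flag_of h = p -> cell_closure w (val h)].
  have SP h : S (flag_of h) <-> cell_closure w (val h).
    split=> [Sh|ch h' /esym/flag_ofP[b [ub unb ->]]]; first exact: Sh.
    by rewrite -[val h]mul1mx; apply: cell_closure_mul => //; exact: upper1.
  have cS : closed S.
    apply: (@closed_of_equations S [set f | poly f /\ forall t, f (cell_point w t) = 0]).
      by move=> f [].
    by move=> h; rewrite SP; split=> [ch f [pf f0]|ch f pf f0]; exact: ch.
  have sub : schubert_cell (R := R) w `<=` S.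
    move=> _ [b ub <-]; apply/SP => /=.
    rewrite -[_ *m _]mulmx1; apply: cell_closure_mul => //; first exact: upper1.
    exact: cell_closure_wmx.
  by move=> cg; apply/SP; move/closure_id: cS => ->; exact: closure_subset sub _ cg.
apply: contrapT => nc.
have [f [pf fg fc]] := closed_separated (@closed_closure _ _) nc.
(* The determinant disposes of the singular cell points, which represent no flag. *)
have : f (val g) * \det (val g) = 0.
  apply: (cg (fun M => f M * \det M)); first by apply: fun_ring_mul => //; exact: poly_det.
  move=> x; have [ux|] := boolP (cell_point w x \in unitmx); last first.
    by rewrite unitmxE unitfE negbK => /eqP ->; rewrite mulr0.
  have [ua ub] := cell_point_unit ux.
  rewrite -[cell_point w x]/(val (mkGL ux)) fc ?mul0r //.
  apply: subset_closure; exists (mkGL ua); first exact: upper_upper_of.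
  apply/flag_ofP; exists (upper_of false x); split=> //; exact: upper_upper_of.
move/eqP; rewrite mulf_eq0 (negbTE fg) /=.
by have := valP g; rewrite unitmxE unitfE => /negbTE ->.
Qed.

(** Total on matrices; the default value never occurs when [x] is unipotent on the low pattern. *)
Definition slice_flag v x : flag_variety R n :=
  if insub (x *m wmx K v) is Some g then flag_of (g : GL R n) else flag_of (GLperm R v).

Lemma slice_flagE v x : unipotent_on (low_pattern v) x ->
  exists2 g, val g = x *m wmx K v & slice_flag v x = flag_of g.
Proof.
move=> ux; have [_ _ un] := slice_point ux.
by exists (mkGL un) => //; rewrite /slice_flag insubT.
Qed.

Lemma kl_varietyE v w : KL v w = [set slice_flag v x | x in kl_slice v w].
Proof.
apply/seteqP; split=> [p [cp [b lb bp]]|_ [x [ux cx] <-]].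
  have lbT : upper (val b)^T by move=> i j ji; rewrite mxE; exact: lb.
  have [x [r [ux ur e]]] := lower_factor v lbT (valP b).
  have [g gE sE] := slice_flagE ux.
  have unr : r \in unitmx.
    have := valP (GLmul b (GLperm R v)).
    by rewrite /= -/(wmx K v) e unitmx_mul => /andP[].
  have pE : p = flag_of g.
    rewrite -bp; apply/esym/flag_ofP; exists r; split=> //.
    by rewrite /= -/(wmx K v) e gE.
  by exists x; rewrite ?sE //; split=> //; rewrite -gE -closure_cellP -pE.
have [g gE sE] := slice_flagE ux; rewrite sE; split.
  by apply/closure_cellP; rewrite gE.
have unx := unipotent_unit (@low_pattern_rank _ v) ux.
exists (mkGL unx).
  move=> i j ij /=; rewrite ux; first by rewrite -val_eqE /= ltn_eqF.
  by rewrite /low_pattern negb_and -leqNgt ltnW ?orbT.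
by apply/flag_ofP; exists 1%:M; split; rewrite ?mulmx1 ?unitmx1 //; exact: upper1.
Qed.

Lemma kl_variety_irreducible v w : bruhat_le v w -> irreducible (KL v w).
Proof.
move=> vw; rewrite kl_varietyE; split.
  by exists (slice_flag v 1%:M), 1%:M => //; exact: kl_slice1.
move=> F G cF cG sub; apply: contrapT => /not_orP[].
move=> /existsNP[_ /not_implyP[[x kx <-] nF]] /existsNP[_ /not_implyP[[y ky <-] nG]].
have [gx gxE sx] := slice_flagE kx.1; have [gy gyE sy] := slice_flagE ky.1.
rewrite sx in nF; rewrite sy in nG.
have [f [pf fx fF]] := closed_separated cF nF; have [f' [pf' fy fG]] := closed_separated cG nG.
case: (@kl_slice_irreducible K n v w f f' pf pf') => [z kz|z|z].
- have [gz gzE sz] := slice_flagE kz.1; rewrite -gzE.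
  have : (F `|` G) (slice_flag v z) by apply: sub; exists z.
  by rewrite sz => -[/fF ->|/fG ->]; rewrite ?mulr0 ?mul0r.
- by rewrite gxE z ?eqxx in fx.
- by rewrite gyE z ?eqxx in fy.
Qed.

Lemma slice_flag_closure v w x : unipotent_on (low_pattern v) x ->
  closure (schubert_cell (R := R) w) (slice_flag v x) <-> cell_closure w (x *m wmx K v).
Proof. by move=> ux; have [g <- ->] := slice_flagE ux; exact: closure_cellP. Qed.

Lemma kl_variety_strict v u w : bruhat_le v u -> bruhat_le u w -> u != w -> KL v u `<` KL v w.
Proof.
move=> vu uw nuw; rewrite !kl_varietyE; split.
  move=> _ [x [ux cx] <-]; exists x => //; split=> //.
  by apply: cell_closure_sub cx; exact: cell_closure_bruhat.
have [x kx ncx] := @kl_slice_strict K n v u w vu uw nuw.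
move=> /(_ (slice_flag v x)) => -[]; first by exists x.
move=> y [uy cy] yx; apply: ncx; apply/(slice_flag_closure _ kx.1).
by rewrite -yx; apply/slice_flag_closure.
Qed.

Lemma label_chain_elements v w (L : seq 'S_n) : label_chain v w L ->
  exists z : nat -> 'S_n, [/\ z 0%N = v, z (size L) = w &
    forall i, (i < size L)%N -> bruhat_step (z i) (z i.+1)].
Proof.
elim=> {v w L} [x|x t y L [a [b tE]] it _ [z [z0 zL zs]]].
  by exists (fun=> x).
exists (fun i => if i is k.+1 then z k else x); split=> //= -[|i] iL; last exact: zs.
by rewrite z0; apply/bruhat_stepP; rewrite it; split=> //; exists a, b; rewrite tE.
Qed.

Lemma label_chain_size v w (L : seq 'S_n) : label_chain v w L -> inv w = (inv v + size L)%N.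
Proof.
elim=> {v w L} [x|x t y L _ it _ ->] /=; first by rewrite addn0.
by rewrite it addSnnS.
Qed.

Lemma kl_chain v w (L : seq 'S_n) : label_chain v w L ->
  irreducible_chain (KL v w) (size L).
Proof.
move=> /label_chain_elements[z [z0 zL zs]].
have le i j : (i <= j)%N -> (j <= size L)%N -> bruhat_le (z i) (z j).
  elim: j => [|j IH]; first by rewrite leqn0 => /eqP -> _; exact: bruhat_le_refl.
  rewrite leq_eqVlt => /orP[/eqP -> _|ij jL]; first exact: bruhat_le_refl.
  by apply: bruhat_le_trans (IH ij (ltnW jL)) (connect1 (zs j jL)).
exists (fun i => KL v (z i)); split=> [i iL|i iL].
  have vi : bruhat_le v (z i) by rewrite -z0; exact: le.
  split; first exact: kl_variety_irreducible.
  exists (closure (schubert_cell (R := R) (z i))); first exact: closed_closure.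
  rewrite kl_varietyE; apply/seteqP; split=> [_ [x [ux cx] <-]|p []].
    split; last by apply/slice_flag_closure.
    rewrite kl_varietyE; exists x => //; split=> //.
    apply: cell_closure_sub cx; apply: cell_closure_bruhat.
    by rewrite -zL; exact: le.
  rewrite kl_varietyE => -[x [ux cx] <-] /slice_flag_closure-/(_ ux) cx'.
  by exists x.
apply: kl_variety_strict; first by rewrite -z0; apply: le => //; exact: ltnW.
  exact/connect1/zs.
by apply/eqP => e; have /bruhat_stepP[] := zs i iL; rewrite e ltnn.
Qed.

Lemma Xmx_point v x : unipotent_on (low_pattern v) x -> Xmx v (x *m wmx K v) = x.
Proof.
move=> /slice_point[_ sx _]; have /(congr1 (mulmx ^~ (invmx (wmx K v)))) := sx.
by rewrite /slice !mulmxK ?wmx_unit.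
Qed.

(** The equation makes sense on good flags only, whereas irreducibility speaks of closed sets of the
    whole flag variety. Adding all flags that are not good, where [good_det] vanishes, gives such a
    set. *)
Lemma closed_slice_zero v f : poly f -> exists2 S : set (flag_variety R n), closed S &
  forall x, unipotent_on (low_pattern v) x -> S (slice_flag v x) <-> f x = 0.
Proof.
move=> pf.
have [p [q [pp pq pqE]]] : rational_on (@entry K n) (good v) (f \o Xmx v).
  by apply: poly_entry_comp pf; [exact: rationalC | exact: rational_Xmx].
pose S := [set z : flag_variety R n |
  forall h, flag_of h = z -> good v (val h) -> f (Xmx v (val h)) = 0].
have SP h : S (flag_of h) <-> (good v (val h) -> f (Xmx v (val h)) = 0).
  split=> [Sh|fh h' /esym/flag_ofP[b [ub unb ->]] gb]; first exact: Sh.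
  have gh : good v (val h).
    rewrite -(mulmxK unb (val h)); apply: good_mul_upper => //; first exact: upper_inv.
    by rewrite unitmx_inv.
  by rewrite /Xmx Amx_mul_upper //; exact: fh.
exists S.
  apply: (@closed_of_equations S [set fun M => p M * good_det v M]).
    by move=> _ ->; apply: fun_ring_mul => //; exact: poly_good_det.
  move=> h; rewrite SP; split=> [fh _ ->|fh gh].
    have [->|/good_detP gh] := eqVneq (good_det v (val h)) 0; first by rewrite mulr0.
    have [q0 /= FE] := pqE _ gh; move: (fh gh); rewrite FE => /eqP.
    by rewrite mulf_eq0 invr_eq0 (negbTE q0) orbF => /eqP ->; rewrite mul0r.
  have [q0 /= ->] := pqE _ gh; have /eqP := fh _ erefl.
  rewrite mulf_eq0; move/good_detP: gh => /negbTE ->; rewrite orbF => /eqP ->.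
  by rewrite mul0r.
move=> x ux; have [g gE ->] := slice_flagE ux; rewrite SP gE Xmx_point //.
by have [gx _ _] := slice_point ux; split=> [/(_ gx)|].
Qed.

Lemma irreducible_chain_bound v w d : irreducible_chain (KL v w) d ->
  (d + inv v <= inv w)%N.
Proof.
move=> [Z [Zirr Zlt]].
pose D i x := kl_slice v w x /\ Z i (slice_flag v x).
have ZKL i p : (i <= d)%N -> Z i p -> KL v w p.
  by move=> id; have [_ [F _ ->]] := Zirr i id => -[].
have ZD i p : (i <= d)%N -> Z i p -> exists2 x, D i x & p = slice_flag v x.
  move=> id Zp; have := ZKL i p id Zp; rewrite kl_varietyE => -[x kx xp].
  by exists x => //; split=> //; rewrite xp.
(* A point of [Z i.+1] outside the closed set that cuts out [Z i] yields [f i], zero on [Z i] and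
   not on [Z i.+1]. *)
have /choice[f fP] : forall i, exists f, poly f /\ ((i < d)%N ->
    (forall x, D i x -> f (x *m wmx K v) = 0) /\
    exists2 x, D i.+1 x & f (x *m wmx K v) != 0).
  move=> i; have [id|] := ltnP i d; last by exists (fun=> 0); split=> //; exact: fun_ring_const.
  have [sub /existsNP[p /not_implyP[Zp nZp]]] := Zlt i id.
  have [x Dx pE] := ZD _ _ id Zp.
  have [_ [F cF FE]] := Zirr i (ltnW id).
  have [g gE sE] := slice_flagE Dx.1.1.
  have nF : ~ F (flag_of g).
    by move=> Fg; apply: nZp; rewrite FE; split; [exact: ZKL Zp | rewrite pE sE].
  have [f [pf fg fF]] := closed_separated cF nF; exists f; split=> // _; split.
    move=> y [ky]; have [h <- ->] := slice_flagE ky.1.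
    by rewrite FE => -[_ /fF].
  by exists x; rewrite // -gE.
have [p0 Zp0] := (Zirr 0%N (leq0n d)).1.1; have [x0 Dx0 _] := ZD _ _ (leq0n d) Zp0.
have pfx i : poly (fun x => f i (x *m wmx K v)).
  have := poly_mul2 1%:M (wmx K v) (fP i).1.
  by under eq_fun do rewrite mul1mx.
have ind j : (j <= d)%N -> independent_on (D j) j (fun i x => f i (x *m wmx K v)).
  elim: j => [_ N c c0 []|j IH jd].
    have := c0 x0 Dx0; rewrite (bigD1 (tt : exponents N 0)) //= big1 => [|[]] //.
    by rewrite addr0 mulr1.
  have [fj0 [x1 Dx1 fx1]] := (fP j).2 jd.
  apply: (independent_step (fun_ringC _) pfx _ _ (IH (ltnW jd)) fj0); last by exists x1.
    by move=> x [kx Zx]; split=> //; exact: (Zlt j jd).1.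
  (* Irreducibility of [Z j.+1] is applied to the closed sets of flags that extend the zero sets of
     [g] and [h]. *)
  move=> g h pg ph gh.
  have [S cS SE] := closed_slice_zero v pg; have [S' cS' SE'] := closed_slice_zero v ph.
  case: ((Zirr _ jd).1.2 S S' cS cS') => [p Zp|sub|sub].
  - have [x Dx ->] := ZD _ _ jd Zp; have /eqP := gh x Dx; rewrite mulf_eq0.
    by case/orP => /eqP z; [left; apply/SE | right; apply/SE'] => //; exact: Dx.1.1.
  - by left=> x Dx; apply/SE; [exact: Dx.1.1 | apply: sub; exact: Dx.2].
  - by right=> x Dx; apply/SE'; [exact: Dx.1.1 | apply: sub; exact: Dx.2].
apply: (@kl_slice_bound K n v w d f x0 (fun i => (fP i).1) Dx0.1).
by apply: independent_pullback (ind d (leqnn d)) => x [kx _]; exists x.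
Qed.

Lemma krull_dim_kl v w : bruhat_le v w ->
  krull_dim R (KL v w) = (inv w - inv v)%N%:R%:E%E.
Proof.
move=> vw; apply/eqP; rewrite eq_le; apply/andP; split.
  apply: ge_ereal_sup => _ [d /irreducible_chain_bound db <-].
  by rewrite lee_fin ler_nat leq_subRL ?bruhat_le_inv // addnC.
apply: ereal_sup_ubound; have [L CL] := exists_label_chain vw.
exists (inv w - inv v)%N => //; rewrite (label_chain_size CL) addKn.
exact: kl_chain.
Qed.

Lemma kl_toricE v w : bruhat_le v w ->
  kl_toric R v w <-> (inv w - inv v)%N = cone_dim (@weight_cone R n v w).
Proof.
move=> vw; rewrite /kl_toric /complexity krull_dim_kl // -EFinB.
split=> [[/eqP]|->]; last by rewrite subrr.
by rewrite subr_eq0 eqr_nat => /eqP.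
Qed.

End Flags.

Theorem proposition3p22 (R : realType) (n : nat) (v w' w : {perm 'I_n})
    (C : seq {perm 'I_n}) (a b : 'I_n) :
  bruhat_le v w' ->
  kl_toric R v w' ->
  saturated_chain v w' C ->
  bruhat_cover w' w ->
  w = perm_compose w' (tperm a b) ->
  (kl_toric R v w <-> ~~ connect (chain_graph C) a b).
Proof.
move=> vw' tor CC cov wE.
have iw : inv w = (inv w').+1 by have /and3P[_ _ /eqP] := cov; rewrite !coxeter_lengthE.
have vw : bruhat_le v w by have /and3P[_ w'w _] := cov; exact: bruhat_le_trans w'w.
have {}tor := (kl_toricE R vw').1 tor.
rewrite (kl_toricE R vw) (cone_dim_cover R CC cov wE) -tor iw subSn ?bruhat_le_inv //.
by case: (connect _ a b); rewrite ?addn1 ?addn0; split=> // /eqP; rewrite eqn_leq ltnn.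
Qed.
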